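(* Let $\sigma$ be a conformal unit defining density for a hypersurface $\Sigma$ in a conformal manifold $(M,\boldsymbol c)$ of dimension $d\ge3$, and let $\tau\in\Gamma(\mathcal E[1])$ be a true scale. Then $$\sigma':=\sigma\left[1+\frac d2\,\log(\sigma/\tau)\,\frac{I_\sigma^2-1}{d+1}\right]$$ obeys $$I^2_{\sigma'}=1+\sigma^{d+1}\big[\log(\sigma/\tau)\,A+B'\big]=1+\tilde{\mathcal O}(\sigma^{d+1})$$ for some smooth $A,B'\in\Gamma(\mathcal E[-d-1])$.
   Context: $(M,\boldsymbol c)$ is a smooth oriented $d$-manifold with a conformal class of Riemannian metrics. $\mathcal E[w]$ is the bundle of conformal densities of weight $w$ (oriented $\frac w{2d}$-th root of $(\Lambda^dTM)^2$; a section is represented by functions $f_g$, $g\in\boldsymbol c$, with $f_{\Omega^2g}=\Omega^wf_g$); $\boldsymbol g$ is the conformal metric. For $g\in\boldsymbol c$, $\nabla$ is the Levi-Civita connection, $\Delta=\boldsymbol g^{ab}\nabla_a\nabla_b$, $\mathrm J=\mathrm{Sc}/(2(d-1))$. For a section $\sigma$ of $\mathcal E[1]$, $$I_\sigma^2:=\boldsymbol g^{ab}(\nabla_a\sigma)(\nabla_b\sigma)-\tfrac2d\,\sigma(\Delta\sigma+\mathrm J\sigma),$$ which is independent of $g\in\boldsymbol c$ (it is the squared length of the scale tractor of $\sigma$). A hypersurface $\Sigma$ is a smoothly embedded codimension-1 submanifold. A defining density for $\Sigma$ is a $\sigma\in\Gamma(\mathcal E[1])$ with zero locus $\Sigma$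 and $\nabla\sigma$ nowhere vanishing along $\Sigma$. It is a conformal unit defining density if it is smooth and $I_\sigma^2=1+\sigma^dB$ for some smooth $B\in\Gamma(\mathcal E[-d])$. A true scale is a nowhere vanishing section $\tau$ of $\mathcal E[1]$. The log density $\log\sigma$ is defined away from $\Sigma$, and $\log(\sigma/\tau)=\log\sigma-\log\tau$ is a section of $\mathcal E[0]$ (a function) there. For densities $f,g$, the notation $f=g+\tilde{\mathcal O}(\sigma^\ell)$ means $f=g+\sigma^\ell\sum_{j=0}^k(\log(\sigma/\tau))^jC_j$ for some non-negative integer $k$, smooth densities $C_j$ and true scale $\tau$.
   Formalization: The middle equality is false when B is nonzero on Σ; the formal statement adds a term σ^{2d}(log(σ/τ))²C with smooth C in E[-2d] to 1+σ^{d+1}[log(σ/τ)A+B'], holding off Σ with log|σ|; the equality with 1+Õ(σ^{d+1}) is kept. *)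

(* Defs.v *)
From mathcomp Require Import all_boot all_order all_algebra.
From mathcomp Require Import all_classical all_reals all_analysis.

Set Implicit Arguments.
Unset Strict Implicit.
Unset Printing Implicit Defensive.

Import Order.TTheory GRing.Theory Num.Theory.
Import numFieldNormedType.Exports.

Local Open Scope classical_set_scope.
Local Open Scope ring_scope.

Section Calculus.
Variables (R : realType) (d : nat).
Implicit Types (U : set 'rV[R]_d) (f : 'rV[R]_d -> R).

Definition partial (i : 'I_d) f : 'rV[R]_d -> R :=
  fun y => 'D_(delta_mx 0 i) f y.

Fixpoint smooth_upto (n : nat) U f : Prop :=
  (forall y, U y -> differentiable f y) /\
  (if n is n'.+1 then forall i, smooth_upto n' U (partial i f) else True).

(* C^oo on an open set: all iterated partial derivatives exist and are
   (Frechet) differentiable, hence also continuous. *)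
Definition smooth_on U f : Prop := forall n, smooth_upto n U f.

End Calculus.

Section Manifold.
Variables (R : realType) (d : nat) (M : topologicalType).

(* A homeomorphism from the open set [dom] onto an open subset of R^d.  The
   values of [coord] off [dom], and of [coordV] off the image, are junk. *)
Record chart := Chart {
  dom : set M;
  coord : M -> 'rV[R]_d;
  coordV : 'rV[R]_d -> M;
  dom_open : open dom;
  img_open : open (coord @` dom);
  coordK : forall x, dom x -> coordV (coord x) = x;
  coord_continuous : forall x, dom x -> {for x, continuous coord};
  coordV_continuous :
    forall y, (coord @` dom) y -> {for y, continuous coordV}
}.

Definition transition (e e' : chart) : 'rV[R]_d -> 'rV[R]_d :=
  fun y => coord e' (coordV e y).

Definition compatible (e e' : chart) : Prop :=
  forall j : 'I_d,
    smooth_on (coord e @` (dom e `&` dom e')) (fun y => transition e e' y 0 j).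

(* Row-vector convention: entry (i, j) of ['J F y] is the i-th partial
   derivative of the j-th component of F. *)
Definition transition_jacobian (e e' : chart) (x : M) : 'M[R]_d :=
  'J (transition e e') (coord e x).

Record oriented_manifold := OrientedManifold {
  atlas : set chart;
  atlas_cover : forall x : M, exists2 e, atlas e & dom e x;
  atlas_compatible : forall e e', atlas e -> atlas e' -> compatible e e';
  atlas_oriented : forall e e', atlas e -> atlas e' ->
    forall x, dom e x -> dom e' x -> 0 < \det (transition_jacobian e e' x);
  manifold_hausdorff : hausdorff_space M;
  manifold_second_countable : @second_countable M
}.

Variable X : oriented_manifold.

(* Used to evaluate quantities that are given in local coordinates by
   tensorial formulas, so that the choice of chart is immaterial. *)
Definition chart_at (x : M) : chart := s2val (cid2 (atlas_cover X x)).

Definition local_rep (e : chart) (f : M -> R) : 'rV[R]_d -> R :=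
  fun y => f (coordV e y).

Definition smooth (f : M -> R) : Prop :=
  forall e, atlas X e -> smooth_on (coord e @` dom e) (local_rep e f).

(* Slice charts; they are compatible with the smooth structure but need not
   belong to the oriented atlas. *)
Definition hypersurface (Sigma : set M) : Prop :=
  forall p, Sigma p -> exists (e : chart) (i : 'I_d),
    [/\ dom e p,
        forall e', atlas X e' -> compatible e e' /\ compatible e' e
      & forall x, dom e x -> (Sigma x <-> coord e x 0 i = 0)].

(* [g e x] is the matrix of components at x of the metric in the chart e; it is
   meaningful only for e in the atlas and x in the domain of e. *)
Definition metric := chart -> M -> 'M[R]_d.

Record riemannian (g : metric) : Prop := Riemannian {
  metric_sym : forall e x, atlas X e -> dom e x -> (g e x)^T = g e x;
  metric_pos : forall e x, atlas X e -> dom e x ->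
    forall v : 'rV[R]_d, v != 0 -> 0 < (v *m g e x *m v^T) 0 0;
  metric_smooth : forall e, atlas X e -> forall a b : 'I_d,
    smooth_on (coord e @` dom e) (local_rep e (fun x => g e x a b));
  metric_change : forall e e', atlas X e -> atlas X e' ->
    forall x, dom e x -> dom e' x ->
      g e x = transition_jacobian e e' x *m g e' x
              *m (transition_jacobian e e' x)^T
}.

(* g' = Omega^2 g *)
Definition rescaled (Omega : M -> R) (g g' : metric) : Prop :=
  [/\ smooth Omega, forall x, 0 < Omega x
    & forall e x, atlas X e -> dom e x -> g' e x = Omega x ^+ 2 *: g e x].

Definition conformal_class (c : set metric) : Prop :=
  exists2 g0, riemannian g0 &
    forall g, c g <-> exists Omega, rescaled Omega g0 g.

Section LeviCivita.
Variables (g : metric) (e : chart).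
Implicit Types (y : 'rV[R]_d) (a b c k : 'I_d) (f : 'rV[R]_d -> R).

Definition metric_lo a b : 'rV[R]_d -> R := fun y => g e (coordV e y) a b.
Definition metric_up a b : 'rV[R]_d -> R :=
  fun y => invmx (g e (coordV e y)) a b.

Definition christoffel c a b : 'rV[R]_d -> R := fun y =>
  2^-1 * \sum_k metric_up c k y *
    (partial a (metric_lo k b) y + partial b (metric_lo k a) y
     - partial k (metric_lo a b) y).

(* R^a_{bcd}, normalised so that (nabla_c nabla_d - nabla_d nabla_c) v^a
   = R^a_{bcd} v^b; round spheres have positive scalar curvature. *)
Definition riemann a b c k : 'rV[R]_d -> R := fun y =>
  partial c (christoffel a k b) y - partial k (christoffel a c b) y
  + \sum_l (christoffel a c l y * christoffel l k b y
            - christoffel a k l y * christoffel l c b y).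

Definition ricci b k : 'rV[R]_d -> R := fun y => \sum_a riemann a b a k y.

Definition scalar_coord : 'rV[R]_d -> R :=
  fun y => \sum_b \sum_k metric_up b k y * ricci b k y.

Definition gradsq_coord f : 'rV[R]_d -> R :=
  fun y => \sum_a \sum_b metric_up a b y * partial a f y * partial b f y.

(* the components of nabla nabla f *)
Definition hessian f a b : 'rV[R]_d -> R := fun y =>
  partial a (partial b f) y - \sum_c christoffel c a b y * partial c f y.

Definition laplacian_coord f : 'rV[R]_d -> R :=
  fun y => \sum_a \sum_b metric_up a b y * hessian f a b y.

End LeviCivita.

Definition gradsq (g : metric) (f : M -> R) : M -> R := fun x =>
  let e := chart_at x in gradsq_coord g e (local_rep e f) (coord e x).

Definition laplacian (g : metric) (f : M -> R) : M -> R := fun x =>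
  let e := chart_at x in laplacian_coord g e (local_rep e f) (coord e x).

Definition Sc (g : metric) : M -> R := fun x =>
  let e := chart_at x in scalar_coord g e (coord e x).

Definition Jcurv (g : metric) : M -> R :=
  fun x => Sc g x / (2 * (d%:R - 1)).

(* A density is given by its representatives f_g; only the values at the
   metrics g of the conformal class matter. *)
Definition density := metric -> M -> R.

Variable c : set metric.

(* f is a section of E[w] *)
Definition smooth_density (w : int) (f : density) : Prop :=
  (forall g, c g -> smooth (f g)) /\
  (forall g g' Omega, c g -> c g' -> rescaled Omega g g' ->
     forall x, f g' x = Omega x ^ w * f g x).

Definition true_scale (tau : density) : Prop :=
  smooth_density 1 tau /\ forall g, c g -> forall x, tau g x != 0.

Definition defining_density (Sigma : set M) (sigma : density) : Prop :=
  [/\ smooth_density 1 sigma,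
      forall g, c g -> forall x, sigma g x = 0 <-> Sigma x
    & forall g, c g -> forall x, Sigma x -> forall e, atlas X e -> dom e x ->
        exists i : 'I_d, partial i (local_rep e (sigma g)) (coord e x) != 0].

(* In the scale g the connection on E[w] acts on the representative f_g as the
   exterior derivative, and the conformal metric is represented by g. *)
Definition Isq (sigma : density) : density := fun g x =>
  gradsq g (sigma g) x
  - 2 / d%:R * sigma g x
    * (laplacian g (sigma g) x + Jcurv g x * sigma g x).

Definition conformal_unit_defining_density
    (Sigma : set M) (sigma : density) : Prop :=
  defining_density Sigma sigma /\
  exists2 B, smooth_density (- d%:Z) B &
    forall g, c g -> forall x, Isq sigma g x = 1 + sigma g x ^+ d * B g x.

(* The absolute value makes log sigma defined on both sides of the zero locus
   of sigma; on the zero locus the value is junk. *)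
Definition log_density (sigma : density) : density :=
  fun g x => ln `|sigma g x|.

Definition log_ratio (sigma tau : density) : density :=
  fun g x => log_density sigma g x - log_density tau g x.

(* f = h + O~(sigma^l) for densities f, h of weight w, away from Sigma *)
Definition eq_Otilde (Sigma : set M) (sigma : density) (w : int) (l : nat)
    (f h : density) : Prop :=
  exists (k : nat) (C : nat -> density) (tau : density),
    [/\ true_scale tau,
        forall j, (j <= k)%N -> smooth_density (w - l%:Z) (C j)
      & forall g, c g -> forall x, ~ Sigma x ->
          f g x = h g x
            + sigma g x ^+ l
              * \sum_(j < k.+1) log_ratio sigma tau g x ^+ j * C j g x].

Definition improved_density (sigma tau : density) : density := fun g x =>
  sigma g x
  * (1 + d%:R / 2 * log_ratio sigma tau g x
         * ((Isq sigma g x - 1) / (d%:R + 1))).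

End Manifold.

(* Main.v *)
(* Away from the zero locus of sigma, I^2 of sigma' expands by the Leibniz rule.
   In its part of degree 0 in the logarithm the coefficient of
   sigma^d B |grad sigma|^2 is
     (d / (2 (d + 1))) (2 + 2/d - 4 (d + 1)/d) = - 1,
   which cancels the term sigma^d B of I^2 of sigma up to order sigma^(d+1); in
   the part of degree 1 the terms of order sigma^d cancel each other.

   We compute in the scale g0 of the class in which |tau| = 1, where
   log (sigma/tau) = log |sigma|, and transport the coefficients to the other
   scales by powers of |tau|.  This uses that I^2 of sigma' does not depend on
   the scale.  In weight 1 the rescaling formula for the Laplacian shows that
   the change of I^2 of a density u is u^2 W with W independent of u; since I^2
   of sigma is invariant by hypothesis, W = 0 off the zero locus, and the
   transformation law of the scalar curvature is not needed.

   The coefficients are smooth because the gradient, the Laplacian and the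
   scalar curvature, which are evaluated in a chosen chart, do not depend on the
   chart: the Christoffel symbols, regarded as matrices Gamma_a, undergo a gauge
   transformation. *)
Require Import Defs.
From mathcomp Require Import all_boot all_order all_algebra.
From mathcomp Require Import all_classical all_reals all_analysis.
From mathcomp Require Import ring lra zify.
(* Again, since vector.v also exports the name [coord]. *)
Import Defs.

Set Implicit Arguments.
Unset Strict Implicit.
Unset Printing Implicit Defensive.

Import Order.TTheory GRing.Theory Num.Theory.
Import numFieldNormedType.Exports.

Local Open Scope classical_set_scope.
Local Open Scope ring_scope.

(** * Partial derivatives and smooth functions *)

(** The exponent d + 1 is resonant. To first order, adding sigma^n b to sigma changes I^2 by
    (2n/d)(d + 1 - n) sigma^(n-1) b |grad sigma|^2 up to higher powers of sigma. This factor
    vanishes at n = d + 1, so no smooth multiple of sigma^(d+1) can remove sigma^d B. A logarithm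
    brings in the n-derivative of the factor at n = d + 1, which is -2(d + 1)/d; the constant d/(2(d
    + 1)) in sigma' is minus its inverse.

    The cancellation leaves sigma^d B (1 - |grad sigma|^2), which is of higher order only because
    the unit condition gives |grad sigma|^2 = 1 on the zero locus.

    I^2 is quadratic, so the correction also contributes sigma^(2d) (log(sigma/tau))^2 C. On the
    zero locus C equals (d/(2(d + 1)))^2 (d^2 - 1) B^2, so in general this term is not of the form
    sigma^(d+1) (log(sigma/tau) A + B') with smooth A and B'. It is kept as a separate term, and 2d
    >= d + 1 places it in the remainder. *)

Lemma near_eq_differentiable (K : numFieldType) (V W : normedModType K)
    (f g : V -> W) (y : V) :
  (\forall z \near y, f z = g z) -> differentiable f y -> differentiable g y.
Proof.
(* The difference [h] vanishes near [y], so its increment is o(id) with zero differential; [g] is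
   then a sum of two differentiable functions. *)
move=> fg df; pose h : V -> W := g \- f.
have h0 : h \o shift y = cst (h y) + (\0 : {linear V -> W}) +o_ 0 id.
  apply/eqaddoP => e e0.
  have fg0 : \forall z \near (0 : V), f (z + y) = g (z + y).
    by rewrite (near_shift y) /=; near=> z; rewrite /= sub0r addrNK; near: z.
  near=> z.
  rewrite /h /= /cst !fctE /= (_ : f (z + y) = g (z + y)); last by near: z.
  rewrite (nbhs_singleton fg) !subrr addr0 subr0 normr0.
  by rewrite mulr_ge0 // ltW.
have dh : differentiable h y.
  have c0 : continuous (\0 : {linear V -> W}) by exact: cst_continuous.
  apply/diff_locallyP; rewrite (diff_unique c0 h0); split => //.
rewrite (_ : g = f + h); first exact: differentiableD.
by apply/funext => z; rewrite !fctE addrC subrK.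
Unshelve. all: by end_near. Qed.

Section PartialDerivatives.
Variables (R : realType) (d : nat).
Implicit Types (U W : set 'rV[R]_d) (f g : 'rV[R]_d -> R) (y : 'rV[R]_d).

Lemma partial_ext i f g y :
  (\forall z \near y, f z = g z) -> partial i f y = partial i g y.
Proof. exact: near_eq_derive. Qed.

Lemma partialE i f y :
  differentiable f y -> partial i f y = 'd f y (delta_mx 0 i).
Proof. exact: deriveE. Qed.

Lemma partial_cst i (a : R) y : partial i (fun=> a) y = 0.
Proof. exact: derive_cst. Qed.

Lemma partialD i f g y : differentiable f y -> differentiable g y ->
  partial i (fun z => f z + g z) y = partial i f y + partial i g y.
Proof. by move=> df dg; rewrite /partial -deriveD //;
  exact: diff_derivable. Qed.

Lemma partialM i f g y : differentiable f y -> differentiable g y ->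
  partial i (fun z => f z * g z) y = f y * partial i g y + g y * partial i f y.
Proof.
move=> df dg; rewrite /partial.
have := @deriveM _ _ f g y (delta_mx 0 i).
by move=> /(_ (diff_derivable df) (diff_derivable dg)) <-.
Qed.

Lemma partialV i f y : differentiable f y -> f y != 0 ->
  partial i (fun z => (f z)^-1) y = - (f y)^-1 ^+ 2 * partial i f y.
Proof.
move=> df f0; rewrite exprVn.
exact: (@deriveV _ _ f y (delta_mx 0 i) f0 (diff_derivable df)).
Qed.

Lemma differentiable_bigsum (I : Type) (r : seq I) (F : I -> 'rV[R]_d -> R) y :
  (forall k, differentiable (F k) y) ->
  differentiable (fun z => \sum_(k <- r) F k z) y.
Proof.
move=> dF; elim: r => [|k r IH].
  by under eq_fun do rewrite big_nil; exact: differentiable_cst.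
by under eq_fun do rewrite big_cons; exact: differentiableD.
Qed.

Lemma partial_sum i (I : Type) (r : seq I) (F : I -> 'rV[R]_d -> R) y :
  (forall k, differentiable (F k) y) ->
  partial i (fun z => \sum_(k <- r) F k z) y = \sum_(k <- r) partial i (F k) y.
Proof.
move=> dF; elim: r => [|k r IH].
  by under eq_fun do rewrite big_nil; rewrite big_nil partial_cst.
under eq_fun do rewrite big_cons; rewrite big_cons partialD ?IH //.
exact: differentiable_bigsum.
Qed.

Lemma differentiable_row (phi : 'rV[R]_d -> 'rV[R]_d) y :
  (forall j, differentiable (fun z => phi z 0 j) y) -> differentiable phi y.
Proof.
move=> dphi.
rewrite (_ : phi = \sum_(j < d) (fun z => phi z 0 j *: delta_mx 0 j)).
  by apply: differentiable_sum => j; exact: differentiableZl.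
by apply/funext => z; rewrite fct_sumE [LHS]row_sum_delta.
Qed.

Lemma partial_coord (phi : 'rV[R]_d -> 'rV[R]_d) i j y :
  (forall j, differentiable (fun z => phi z 0 j) y) ->
  'd phi y (delta_mx 0 i) 0 j = partial i (fun z => phi z 0 j) y.
Proof.
move=> dphi; have dp := differentiable_row dphi.
rewrite -(deriveE _ dp) derive_mx; last exact: diff_derivable.
by rewrite mxE.
Qed.

Lemma jacobianE (phi : 'rV[R]_d -> 'rV[R]_d) y :
  (forall j, differentiable (fun z => phi z 0 j) y) ->
  'J phi y = \matrix_(i, j) partial i (fun z => phi z 0 j) y.
Proof.
by move=> dphi; apply/matrixP => i j; rewrite !mxE partial_coord //.
Qed.

Lemma differentiable_compr (phi : 'rV[R]_d -> 'rV[R]_d) f y :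
  (forall j, differentiable (fun z => phi z 0 j) y) ->
  differentiable f (phi y) -> differentiable (fun z => f (phi z)) y.
Proof.
by move=> dphi df; apply: differentiable_comp => //; exact: differentiable_row.
Qed.

Lemma partial_comp (phi : 'rV[R]_d -> 'rV[R]_d) f i y :
  (forall j, differentiable (fun z => phi z 0 j) y) ->
  differentiable f (phi y) ->
  partial i (fun z => f (phi z)) y =
  \sum_j partial i (fun z => phi z 0 j) y * partial j f (phi y).
Proof.
move=> dphi df; have dp := differentiable_row dphi.
rewrite partialE; last exact: differentiable_compr.
rewrite (_ : (fun z => _) = f \o phi) // diff_comp //=.
rewrite [X in 'd f _ X]row_sum_delta linear_sum.
apply: eq_bigr => j _; rewrite linearZ /= partial_coord //.
by rewrite [partial j f _]partialE.
Qed.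

Lemma partial_comp1 (h : R -> R) (h' : R) f i y :
  differentiable f y -> is_derive (f y) 1 h h' ->
  differentiable (fun z => h (f z)) y /\
  partial i (fun z => h (f z)) y = h' * partial i f y.
Proof.
move=> df [dh <-]; have dh' : differentiable h (f y) by exact/derivable1_diffP.
have dhf : differentiable (h \o f) y by exact: differentiable_comp.
split; first exact: dhf.
rewrite partialE // (_ : (fun z => _) = h \o f) // diff_comp //= -partialE //.
by rewrite -[X in 'd h _ X]mulr1 linearZ /= -deriveE // mulrC.
Qed.

End PartialDerivatives.

Section SmoothFunctions.
Variables (R : realType) (d : nat).
Implicit Types (U W : set 'rV[R]_d) (f g : 'rV[R]_d -> R) (y : 'rV[R]_d).

Lemma smooth_upto_sub n U W f :
  (forall y, W y -> U y) -> smooth_upto n U f -> smooth_upto n W f.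
Proof.
move=> WU; elim: n f => [|n IH] f /= [df sf]; split=> //.
- by move=> y /WU /df.
- by move=> y /WU /df.
- by move=> i; exact: IH.
Qed.

Lemma smooth_upto_le n U f : smooth_upto n.+1 U f -> smooth_upto n U f.
Proof.
elim: n f => [|n IH] f /= [df sf]; split=> // i; exact/IH/sf.
Qed.

(** The derivatives in [smooth_upto] are those of a function on the whole space, so the set enters
    only pointwise and singletons suffice. Hence [smooth_on_local] does not ask for open covering
    sets. *)
Lemma smooth_upto_pt n U f :
  (forall y, U y -> smooth_upto n [set y] f) -> smooth_upto n U f.
Proof.
elim: n f => [|n IH] f sf; split=> //.
- by move=> y /sf [df _]; exact: df.
- by move=> y /sf [df _]; exact: df.
- by move=> i; apply: IH => y /sf [_ sfi]; exact: sfi.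
Qed.

Lemma smooth_upto_diff n U f y : smooth_upto n U f -> U y -> differentiable f y.
Proof. by case: n => [|n] [df _]; exact: df. Qed.

Lemma smooth_upto_ext n U f g : open U -> (forall y, U y -> f y = g y) ->
  smooth_upto n U f -> smooth_upto n U g.
Proof.
move=> oU; elim: n f g => [|n IH] f g fg [df sf].
  split=> // y Uy; apply: near_eq_differentiable (df y Uy).
  by apply: filterS (open_nbhs_nbhs (conj oU Uy)) => z /fg.
split=> [y Uy|i].
  apply: near_eq_differentiable (df y Uy).
  by apply: filterS (open_nbhs_nbhs (conj oU Uy)) => z /fg.
apply: IH (sf i) => y Uy; apply: partial_ext.
by apply: filterS (open_nbhs_nbhs (conj oU Uy)) => z /fg.
Qed.

Lemma smooth_upto_cst n U (a : R) : smooth_upto n U (fun=> a).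
Proof.
elim: n a => [|n IH] a; (split; first by move=> y _; exact: differentiable_cst).
  by [].
move=> i; rewrite (_ : partial i _ = fun=> 0); first exact: IH.
by apply/funext => y; exact: partial_cst.
Qed.

Lemma smooth_uptoD n U f g : open U -> smooth_upto n U f -> smooth_upto n U g ->
  smooth_upto n U (fun y => f y + g y).
Proof.
move=> oU; elim: n f g => [|n IH] f g [df sf] [dg sg].
  by split=> // y Uy; apply: differentiableD; [exact: df|exact: dg].
split=> [y Uy|i]; first by apply: differentiableD; [exact: df|exact: dg].
apply: smooth_upto_ext (IH _ _ (sf i) (sg i)) => // y Uy.
by rewrite partialD //; [exact: df|exact: dg].
Qed.

Lemma smooth_uptoM n U f g : open U -> smooth_upto n U f -> smooth_upto n U g ->
  smooth_upto n U (fun y => f y * g y).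
Proof.
move=> oU; elim: n f g => [|n IH] f g sf sg.
  by split=> // y Uy; apply: differentiableM;
    [exact: smooth_upto_diff sf Uy|exact: smooth_upto_diff sg Uy].
split=> [y Uy|i]; first by apply: differentiableM;
  [exact: smooth_upto_diff sf Uy|exact: smooth_upto_diff sg Uy].
apply: smooth_upto_ext (smooth_uptoD oU
  (IH _ _ (smooth_upto_le sf) (sg.2 i)) (IH _ _ (smooth_upto_le sg) (sf.2 i)))
  => // y Uy.
by rewrite partialM //; [exact: smooth_upto_diff sf Uy|exact: smooth_upto_diff
  sg Uy].
Qed.

Lemma smooth_uptoV n U f : open U -> (forall y, U y -> f y != 0) ->
  smooth_upto n U f -> smooth_upto n U (fun y => (f y)^-1).
Proof.
move=> oU f0; elim: n => [|n IH] sf.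
  split=> // y Uy; apply: differentiableV; last exact: f0.
  exact: smooth_upto_diff sf Uy.
split=> [y Uy|i].
  apply: differentiableV; last exact: f0.
  exact: smooth_upto_diff sf Uy.
have sV := IH (smooth_upto_le sf).
apply: smooth_upto_ext (smooth_uptoM oU (smooth_uptoM oU (smooth_upto_cst n U
  (-1))
  (smooth_uptoM oU sV sV)) (sf.2 i)) => // y Uy.
by rewrite partialV ?f0 ?mulN1r ?expr2//; exact: smooth_upto_diff sf Uy.
Qed.

Lemma smooth_upto_sum n U (I : Type) (r : seq I) (F : I -> 'rV[R]_d -> R) :
  open U -> (forall k, smooth_upto n U (F k)) ->
  smooth_upto n U (fun y => \sum_(k <- r) F k y).
Proof.
move=> oU sF; elim: r => [|k r IH].
  by under eq_fun do rewrite big_nil; exact: smooth_upto_cst.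
by under eq_fun do rewrite big_cons; exact: smooth_uptoD.
Qed.

Lemma smooth_upto_comp n U W (phi : 'rV[R]_d -> 'rV[R]_d) f :
  open U -> (forall y, U y -> W (phi y)) ->
  (forall j, smooth_upto n U (fun y => phi y 0 j)) ->
  smooth_upto n W f -> smooth_upto n U (fun y => f (phi y)).
Proof.
move=> oU UW; elim: n f => [|n IH] f sphi sf.
  split=> // y Uy; apply: differentiable_compr => [j|].
    exact: smooth_upto_diff (sphi j) Uy.
  exact: smooth_upto_diff sf (UW _ Uy).
split=> [y Uy|i].
  apply: differentiable_compr => [j|].
    exact: smooth_upto_diff (sphi j) Uy.
  exact: smooth_upto_diff sf (UW _ Uy).
have sphi' j : smooth_upto n U (fun y => phi y 0 j).
  exact/smooth_upto_le/sphi.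
apply: smooth_upto_ext (smooth_upto_sum (index_enum 'I_d) oU
  (fun j => smooth_uptoM oU ((sphi j).2 i) (IH _ sphi' (sf.2 j)))) => // y Uy.
rewrite partial_comp // => [j|]; first exact: (sphi j).1.
exact: sf.1 (UW _ Uy).
Qed.

Lemma smooth_on_diff U f y : smooth_on U f -> U y -> differentiable f y.
Proof. by move=> sf; exact: smooth_upto_diff (sf 0%N). Qed.

Lemma smooth_on_partial U f i : smooth_on U f -> smooth_on U (partial i f).
Proof. by move=> sf n; exact: (sf n.+1).2. Qed.

Lemma smooth_on_intro U f : (forall y, U y -> differentiable f y) ->
  (forall i, smooth_on U (partial i f)) -> smooth_on U f.
Proof. by move=> df sf [|n]; split=> // i; exact: sf. Qed.

Lemma smooth_on_sub U W f :
  (forall y, W y -> U y) -> smooth_on U f -> smooth_on W f.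
Proof. by move=> WU sf n; exact: smooth_upto_sub WU (sf n). Qed.

Lemma smooth_on_local U f :
  (forall y, U y -> exists2 W, W y & smooth_on W f) -> smooth_on U f.
Proof.
move=> sf n; apply: smooth_upto_pt => y /sf [W Wy sW].
by apply: smooth_upto_sub (sW n) => z ->.
Qed.

Lemma smooth_on_ext U f g : open U -> (forall y, U y -> f y = g y) ->
  smooth_on U f -> smooth_on U g.
Proof. by move=> oU fg sf n; exact: smooth_upto_ext (sf n). Qed.

Lemma smooth_on_cst U (a : R) : smooth_on U (fun=> a).
Proof. by move=> n; exact: smooth_upto_cst. Qed.

Lemma smooth_onD U f g : open U -> smooth_on U f -> smooth_on U g ->
  smooth_on U (fun y => f y + g y).
Proof. by move=> oU sf sg n; exact: smooth_uptoD. Qed.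

Lemma smooth_onM U f g : open U -> smooth_on U f -> smooth_on U g ->
  smooth_on U (fun y => f y * g y).
Proof. by move=> oU sf sg n; exact: smooth_uptoM. Qed.

Lemma smooth_onV U f : open U -> (forall y, U y -> f y != 0) ->
  smooth_on U f -> smooth_on U (fun y => (f y)^-1).
Proof. by move=> oU f0 sf n; exact: smooth_uptoV. Qed.

Lemma smooth_onN U f : open U -> smooth_on U f -> smooth_on U (fun y => - f y).
Proof.
move=> oU sf; under eq_fun do rewrite -mulN1r.
by apply: smooth_onM => //; exact: smooth_on_cst.
Qed.

Lemma smooth_onB U f g : open U -> smooth_on U f -> smooth_on U g ->
  smooth_on U (fun y => f y - g y).
Proof. by move=> oU sf sg; apply: smooth_onD => //; exact: smooth_onN. Qed.

Lemma smooth_onX U f n : open U -> smooth_on U f ->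
  smooth_on U (fun y => f y ^+ n).
Proof.
move=> oU sf; elim: n => [|n IH].
  by under eq_fun do rewrite expr0; exact: smooth_on_cst.
by under eq_fun do rewrite exprS; exact: smooth_onM.
Qed.

Lemma smooth_on_sum U (I : Type) (r : seq I) (F : I -> 'rV[R]_d -> R) :
  open U -> (forall k, smooth_on U (F k)) ->
  smooth_on U (fun y => \sum_(k <- r) F k y).
Proof. by move=> oU sF n; apply: smooth_upto_sum => // k; exact: sF. Qed.

Lemma smooth_on_prod U (I : Type) (r : seq I) (F : I -> 'rV[R]_d -> R) :
  open U -> (forall k, smooth_on U (F k)) ->
  smooth_on U (fun y => \prod_(k <- r) F k y).
Proof.
move=> oU sF; elim: r => [|k r IH].
  by under eq_fun do rewrite big_nil; exact: smooth_on_cst.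
by under eq_fun do rewrite big_cons; exact: smooth_onM.
Qed.

Lemma smooth_on_comp U W (phi : 'rV[R]_d -> 'rV[R]_d) f :
  open U -> (forall y, U y -> W (phi y)) ->
  (forall j, smooth_on U (fun y => phi y 0 j)) ->
  smooth_on W f -> smooth_on U (fun y => f (phi y)).
Proof.
move=> oU UW sphi sf n; apply: (smooth_upto_comp (W := W)) => // j.
exact: sphi.
Qed.

Lemma smooth_on_det U m (A : 'rV[R]_d -> 'M[R]_m) : open U ->
  (forall i j, smooth_on U (fun y => A y i j)) ->
  smooth_on U (fun y => \det (A y)).
Proof.
move=> oU sA; rewrite /determinant; apply: smooth_on_sum => // s.
apply: smooth_onM => //; first exact: smooth_on_cst.
by apply: smooth_on_prod => // i; exact: sA.
Qed.

Lemma smooth_on_invmx U m (A : 'rV[R]_d -> 'M[R]_m) : open U ->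
  (forall y, U y -> A y \in unitmx) ->
  (forall i j, smooth_on U (fun y => A y i j)) ->
  forall i j, smooth_on U (fun y => invmx (A y) i j).
Proof.
move=> oU uA sA i j.
apply: (@smooth_on_ext _ (fun y => (\det (A y))^-1 * cofactor (A y) j i)) => //.
  by move=> y Uy; rewrite /invmx uA // !mxE.
apply: smooth_onM => //.
  apply: smooth_onV => //; last exact: smooth_on_det.
  by move=> y /uA; rewrite unitmxE unitfE.
apply: smooth_onM => //; first exact: smooth_on_cst.
by apply: smooth_on_det => // k l; under eq_fun do rewrite !mxE; exact: sA.
Qed.

Lemma smooth_on_open_neq0 U f : open U -> smooth_on U f ->
  open (U `&` [set y | f y != 0]).
Proof.
move=> oU sf; rewrite openE => y [Uy fy]; apply: filterI.
  exact: open_nbhs_nbhs.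
have cf : {for y, continuous f}.
  by apply: differentiable_continuous; exact: smooth_on_diff sf Uy.
by apply: (cf [set t | t != 0]); apply: open_nbhs_nbhs; split.
Qed.

(* Away from its zeros f has locally constant sign, so [`|f|] and [ln `|f|]
   reduce to the case of a positive function. *)
Lemma near_sg U f y : open U -> smooth_on U f -> U y -> f y != 0 ->
  \forall z \near y, `|f z| = Num.sg (f y) * f z.
Proof.
move=> oU sf Uy fy.
have cf : {for y, continuous f}.
  by apply: differentiable_continuous; exact: smooth_on_diff sf Uy.
have [fy0|fy0|fy0] := ltgtP (f y) 0; last by rewrite fy0 eqxx in fy.
- have : \forall z \near y, f z < 0.
    by apply: (cf [set t | t < 0]); apply: open_nbhs_nbhs; split.
  by apply: filterS => z /= z0; rewrite ltr0_norm // ltr0_sg // mulN1r.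
- have : \forall z \near y, f z > 0.
    by apply: (cf [set t | t > 0]); apply: open_nbhs_nbhs; split.
  by apply: filterS => z /= z0; rewrite gtr0_norm // gtr0_sg // mul1r.
Qed.

Lemma smooth_on_norm U f : open U -> (forall y, U y -> f y != 0) ->
  smooth_on U f -> smooth_on U (fun y => `|f y|).
Proof.
move=> oU f0 sf; apply: smooth_on_local => y Uy.
have : nbhs y [set z | `|f z| = Num.sg (f y) * f z].
  exact: near_sg oU sf Uy (f0 _ Uy).
rewrite nbhsE => -[W [oW Wy] WE].
have oWU : open (W `&` U) by exact: openI.
exists (W `&` U) => //.
apply: (@smooth_on_ext _ (fun z => Num.sg (f y) * f z)) => //.
  by move=> z [Wz _]; rewrite (WE z Wz).
apply: smooth_onM => //; first exact: smooth_on_cst.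
by apply: smooth_on_sub sf => z [].
Qed.

Lemma is_diff_ln_norm U f y : open U -> smooth_on U f -> U y -> f y != 0 ->
  differentiable (fun z => ln `|f z|) y /\
  forall i, partial i (fun z => ln `|f z|) y = partial i f y / f y.
Proof.
move=> oU sf Uy fy; pose h z := Num.sg (f y) * f z.
have nh := near_sg oU sf Uy fy.
have df := smooth_on_diff sf Uy.
have dc : differentiable (fun=> Num.sg (f y) : R) y by exact:
  differentiable_cst.
have dh : differentiable h y by exact: differentiableM.
have hy : h y = `|f y| by rewrite (nbhs_singleton nh).
have h0 : 0 < h y by rewrite hy normr_gt0.
have dl i := partial_comp1 i dh (is_derive1_ln h0).
have nl : \forall z \near y, ln (h z) = ln `|f z|.
  by apply: filterS nh => z ->.
split=> [|i].
  apply: near_eq_differentiable nl _; apply: differentiable_comp => //.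
  by apply/derivable1_diffP; have [] := is_derive1_ln h0.
rewrite -(partial_ext _ nl) (dl i).2 partialM // partial_cst mulr0 addr0.
by rewrite /h invfM mulrACA mulVf ?sgr_eq0 // mul1r mulrC.
Qed.

(** By [smooth_on_intro] only first derivatives matter, and [partial i f y / f y] no longer contains
    the logarithm. *)
Lemma smooth_on_ln_norm U f : open U -> (forall y, U y -> f y != 0) ->
  smooth_on U f -> smooth_on U (fun y => ln `|f y|).
Proof.
move=> oU f0 sf; apply: smooth_on_intro => [y Uy|i].
  exact: (is_diff_ln_norm oU sf Uy (f0 _ Uy)).1.
apply: (@smooth_on_ext _ (fun y => partial i f y / f y)) => //.
  by move=> y Uy; rewrite (is_diff_ln_norm oU sf Uy (f0 _ Uy)).2.
apply: smooth_onM => //; first exact: smooth_on_partial.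
exact: smooth_onV.
Qed.

(* The two iterated derivatives are both the limit of the second difference
   quotient, by the mean value theorem applied to its first difference. *)
Lemma second_difference f y (u v : 'rV[R]_d) (e : R) :
  0 < e -> `|u| <= 1 -> `|v| <= 1 ->
  (\forall z \near y, differentiable f z) ->
  differentiable (fun z => 'D_u f z) y ->
  exists2 r, 0 < r & forall t, 0 < t -> t < r ->
    `|f (t *: u + t *: v + y) - f (t *: u + y) - f (t *: v + y) + f y
      - t ^+ 2 * 'D_v (fun z => 'D_u f z) y| <= 3 * e * t ^+ 2.
Proof.
move=> e0 u1 v1 df dF; pose F z := 'D_u f z.
have : \forall h \near (0 : 'rV[R]_d), differentiable f (h + y).
  by rewrite (near_shift y) /=; near=> z; rewrite /= sub0r addrNK; near: z.
have /eqaddoP/(_ e e0) := diff_locally dF.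
move=> /nbhs_normP[r1 /= r10 H1] /nbhs_normP[r2 /= r20 H2].
(* Halved because the points used lie at distance up to 2t from [y]. *)
exists (Num.min r1 r2 / 2); first by rewrite divr_gt0 // lt_min r10.
move=> t t0; rewrite ltr_pdivlMr // lt_min => /andP[tr1 tr2].
have bnd (s : R) (w : 'rV[R]_d) : 0 <= s -> s <= t -> `|w| <= 1 ->
    `|s *: w| <= t.
  move=> s0 st w1; rewrite normrZ ger0_norm //.
  by rewrite -[leRHS]mulr1; exact: ler_pM.
have bndD (s : R) : 0 <= s -> s <= t -> `|s *: u + t *: v| <= t * 2.
  move=> s0 st; rewrite (le_trans (ler_normD _ _)) // mulr_natr mulr2n.
  by apply: lerD; apply: bnd => //; exact: ltW.
have near2 w : `|w| <= t * 2 -> differentiable f (w + y).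
  by move=> wt; apply: H2; rewrite /= sub0r normrN (le_lt_trans wt).
have near1 w : `|w| <= t * 2 -> `|F (w + y) - F y - 'd F y w| <= e * `|w|.
  move=> wt; have := H1 w; rewrite /= sub0r normrN (le_lt_trans wt) // =>
    /(_ isT).
  by rewrite !fctE /= opprD addrA.
have t2 : t <= t * 2 by rewrite ler_peMr ?ler1n // ltW.
pose g r := f (r *: u + t *: v + y) - f (r *: u + y).
have dline w r : `|r *: u + w| <= t * 2 ->
    is_derive r 1 (fun r => f (r *: u + w + y)) (F (r *: u + w + y)).
  move=> rw; have dfr := near2 _ rw.
  have [dA vA] : is_diff r (( *:%R ^~ u) + cst (w + y)) (( *:%R ^~ u) + 0).
    exact: is_diffD.
  pose A := ( *:%R ^~ u) + cst (w + y).
  have -> : (fun r => f (r *: u + w + y)) = f \o A.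
    by apply/funext => s; rewrite /A /= !fctE addrA.
  have Ar : A r = r *: u + w + y by rewrite /A !fctE addrA.
  have dfA : differentiable f (A r) by rewrite Ar.
  have dc : differentiable (f \o A) r by exact: differentiable_comp.
  apply: DeriveDef; first exact: diff_derivable.
  rewrite deriveE // diff_comp //= vA !fctE scale1r addr0.
  by rewrite Ar /F deriveE.
have dline0 r : `|r *: u| <= t * 2 ->
    is_derive r 1 (fun r => f (r *: u + y)) (F (r *: u + y)).
  move=> ru; have := @dline 0 r; rewrite addr0 => /(_ ru).
  by under [X in is_derive _ _ X]eq_fun do rewrite addr0.
have dg r : r \in `]0, t[%R ->
    is_derive r 1 g (F (r *: u + t *: v + y) - F (r *: u + y)).
  rewrite in_itv /= => /andP[/ltW r0 /ltW rt].
  have := is_deriveB (dline _ _ (bndD _ r0 rt))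
    (dline0 r (le_trans (bnd _ _ r0 rt u1) t2)).
  exact.
have cg : {within `[0, t], continuous g}.
  apply: derivable_within_continuous => r.
  rewrite in_itv /= => /andP[r0 rt]; apply: derivableB.
    by have [] := dline _ _ (bndD _ r0 rt).
  by have [] := dline0 r (le_trans (bnd _ _ r0 rt u1) t2).
have [r] := MVT t0 dg cg; rewrite in_itv /= => /andP[/ltW r0 /ltW rt].
rewrite subr0 {1 2}/g !scale0r !add0r => gE.
have n1 := near1 _ (bndD _ r0 rt).
have n2 : `|F (r *: u + y) - F y - 'd F y (r *: u)| <= e * `|r *: u|.
  exact/near1/(le_trans (bnd _ _ r0 rt u1) t2).
have e1 := bndD _ r0 rt; have e2 := bnd _ _ r0 rt u1.
have dv : 'd F y (t *: v) = t * 'D_v F y by rewrite linearZ deriveE.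
move: n1 n2; rewrite linearD dv.
set a := F _; set b := F (r *: u + y); rewrite -/F; set D := 'D_v F y; set du :=
  'd F y _.
move=> n1 n2.
have -> : f (t *: u + t *: v + y) - f (t *: u + y) - f (t *: v + y) + f y
    - t ^+ 2 * D = t * ((a - F y - (du + t * D)) - (b - F y - du)).
  rewrite (_ : _ + f y = f (t *: u + t *: v + y) - f (t *: u + y)
    - (f (t *: v + y) - f y)); last by ring.
  rewrite gE /a /b; ring.
(* The two linearisation errors of [F] are at most 2et and et, whence the constant 3; the other
   factor t comes from the mean value theorem. *)
rewrite normrM gtr0_norm // expr2 mulrCA ler_pM2l // mulrAC.
rewrite (le_trans (ler_normB _ _)) // (le_trans (lerD n1 n2)) //; nra.
Unshelve. all: by end_near. Qed.

Lemma partialC f y i j : (\forall z \near y, differentiable f z) ->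
  differentiable (partial i f) y -> differentiable (partial j f) y ->
  partial i (partial j f) y = partial j (partial i f) y.
Proof.
move=> df di dj.
suff : `|partial i (partial j f) y - partial j (partial i f) y| <= 0.
  by rewrite normr_le0 subr_eq0 => /eqP.
have n1 (k : 'I_d) : `|delta_mx 0 k : 'rV[R]_d| <= 1.
  rewrite [leLHS]/Num.Def.normr /= mx_normrE bigmax_le // => -[a b] _.
  by rewrite mxE; case: (_ && _) => /=; rewrite ?normr1 ?normr0.
apply/ler_addgt0Pr => e e0; rewrite add0r.
(* Two estimates with error 3(e/6)t^2 add up to e t^2. The second difference is symmetric in the two
   directions, so it drops out. *)
have e6 : 0 < e / 6 by rewrite divr_gt0.
have [r r0 H1] := second_difference e6 (n1 i) (n1 j) df di.
have [s s0 H2] := second_difference e6 (n1 j) (n1 i) df dj.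
pose t := Num.min r s / 2.
have m0 : 0 < Num.min r s by rewrite lt_min r0.
have t0 : 0 < t by rewrite divr_gt0.
have tm : t < Num.min r s by rewrite /t ltr_pdivrMr // ltr_pMr // ltr1n.
have {tm} [tr ts] : t < r /\ t < s by apply/andP; rewrite -lt_min.
have := lerD (H1 t t0 tr) (H2 t t0 ts); rewrite -/(partial i f) -/(partial j f).
rewrite -/(partial j (partial i f) y) -/(partial i (partial j f) y).
rewrite (addrC (t *: delta_mx 0 j) (t *: delta_mx 0 i)) => {H1 H2}.
set a := _ - _ - _ + _; set b := _ - _ - _ + _.
have -> : b = a by rewrite /a /b; ring.
rewrite [X in X + _]distrC => /(le_trans (ler_normD _ _)).
rewrite addrA subrK -mulrBr normrM normrX gtr0_norm //.
rewrite -mulrDl mulrC ler_pM2r; last by rewrite exprn_gt0.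
by rewrite [X in _ -> X <= _]distrC (_ : 3 * _ + _ = e) //; field.
Qed.

Lemma smooth_on_partialC U f y i j : open U -> smooth_on U f -> U y ->
  partial i (partial j f) y = partial j (partial i f) y.
Proof.
move=> oU sf Uy; apply: partialC.
- apply: filterS (open_nbhs_nbhs (conj oU Uy)) => z.
  exact: smooth_on_diff.
- exact: smooth_on_diff (smooth_on_partial i sf) Uy.
- exact: smooth_on_diff (smooth_on_partial j sf) Uy.
Qed.

End SmoothFunctions.

(** * The Levi-Civita connection *)

Section MatrixCalculus.
Variables (R : realType) (d : nat).
Implicit Types (U : set 'rV[R]_d) (y : 'rV[R]_d).

Definition dmx m n (A : 'rV[R]_d -> 'M[R]_(m, n)) (a : 'I_d) y : 'M[R]_(m, n) :=
  \matrix_(i, j) partial a (fun z => A z i j) y.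

Definition mx_smooth m n U (A : 'rV[R]_d -> 'M[R]_(m, n)) :=
  forall i j, smooth_on U (fun z => A z i j).

Lemma mx_smooth_dmx m n U (A : 'rV[R]_d -> 'M[R]_(m, n)) a :
  mx_smooth U A -> mx_smooth U (dmx A a).
Proof.
move=> sA i j; under eq_fun do rewrite mxE.
by apply: smooth_on_partial; exact: sA.
Qed.

Lemma mx_smoothM m n p U (A : 'rV[R]_d -> 'M[R]_(m, n))
    (B : 'rV[R]_d -> 'M[R]_(n, p)) : open U ->
  mx_smooth U A -> mx_smooth U B -> mx_smooth U (fun z => A z *m B z).
Proof.
move=> oU sA sB i j; under eq_fun do rewrite mxE.
by apply: smooth_on_sum => // k; apply: smooth_onM.
Qed.

Lemma dmx_ext m n U (A B : 'rV[R]_d -> 'M[R]_(m, n)) a y : open U ->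
  (forall z, U z -> A z = B z) -> U y -> dmx A a y = dmx B a y.
Proof.
move=> oU AB Uy; apply/matrixP => i j; rewrite !mxE; apply: partial_ext.
by apply: filterS (open_nbhs_nbhs (conj oU Uy)) => z /AB ->.
Qed.

Lemma dmxD m n U (A B : 'rV[R]_d -> 'M[R]_(m, n)) a y :
  mx_smooth U A -> mx_smooth U B -> U y ->
  dmx (fun z => A z + B z) a y = dmx A a y + dmx B a y.
Proof.
move=> sA sB Uy; apply/matrixP => i j; rewrite !mxE.
under [X in partial a X]eq_fun do rewrite mxE.
by rewrite partialD //; [exact: smooth_on_diff (sA _ _) Uy
                        |exact: smooth_on_diff (sB _ _) Uy].
Qed.

Lemma dmxM m n p U (A : 'rV[R]_d -> 'M[R]_(m, n))
    (B : 'rV[R]_d -> 'M[R]_(n, p)) a y :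
  mx_smooth U A -> mx_smooth U B -> U y ->
  dmx (fun z => A z *m B z) a y = dmx A a y *m B y + A y *m dmx B a y.
Proof.
move=> sA sB Uy; apply/matrixP => i j; rewrite !mxE.
under [X in partial a X]eq_fun do rewrite mxE.
have dA i k : differentiable (fun z => A z i k) y := smooth_on_diff (sA i k) Uy.
have dB k j : differentiable (fun z => B z k j) y := smooth_on_diff (sB k j) Uy.
rewrite partial_sum => [|k]; last exact: differentiableM.
rewrite -big_split; apply: eq_bigr => k _ /=.
by rewrite partialM // !mxE addrC [B y k j * _]mulrC.
Qed.

Lemma dmx_tr m n (A : 'rV[R]_d -> 'M[R]_(m, n)) a y :
  dmx (fun z => (A z)^T) a y = (dmx A a y)^T.
Proof.
apply/matrixP => i j; rewrite !mxE.
by under eq_fun do rewrite mxE.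
Qed.

Lemma dmx_sum m n U (I : finType) (A : I -> 'rV[R]_d -> 'M[R]_(m, n)) a y :
  (forall k, mx_smooth U (A k)) -> U y ->
  dmx (fun z => \sum_k A k z) a y = \sum_k dmx (A k) a y.
Proof.
move=> sA Uy; apply/matrixP => i j; rewrite !mxE summxE.
under [X in partial a X]eq_fun do rewrite summxE.
rewrite partial_sum => [|k]; last exact: smooth_on_diff (sA k i j) Uy.
by apply: eq_bigr => k _; rewrite mxE.
Qed.

Lemma dmxZ m n U (f : 'rV[R]_d -> R) (A : 'rV[R]_d -> 'M[R]_(m, n)) a y :
  smooth_on U f -> mx_smooth U A -> U y ->
  dmx (fun z => f z *: A z) a y = partial a f y *: A y + f y *: dmx A a y.
Proof.
move=> sf sA Uy; apply/matrixP => i j; rewrite !mxE.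
under [X in partial a X]eq_fun do rewrite mxE.
rewrite partialM; first by rewrite addrC [A y i j * _]mulrC.
  exact: smooth_on_diff sf Uy.
exact: smooth_on_diff (sA i j) Uy.
Qed.

Lemma dmx_comp m n U W (phi : 'rV[R]_d -> 'rV[R]_d)
    (A : 'rV[R]_d -> 'M[R]_(m, n)) a y :
  (forall j, smooth_on U (fun z => phi z 0 j)) -> mx_smooth W A ->
  U y -> W (phi y) ->
  dmx (fun z => A (phi z)) a y =
  \sum_i partial a (fun z => phi z 0 i) y *: dmx A i (phi y).
Proof.
move=> sphi sA Uy Wy; apply/matrixP => i j; rewrite !mxE summxE.
rewrite (partial_comp (f := fun z => A z i j)) => [|k|].
- by apply: eq_bigr => k _; rewrite !mxE.
- exact: smooth_on_diff (sphi k) Uy.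
- exact: smooth_on_diff (sA i j) Wy.
Qed.

End MatrixCalculus.

Section LeviCivitaAlgebra.
Variables (R : realType) (d : nat) (G : 'M[R]_d) (D : 'I_d -> 'M[R]_d).
Hypotheses (Gunit : G \in unitmx) (Gsym : G^T = G).
Hypothesis Dsym : forall a, (D a)^T = D a.

(* [D a] stands for the matrix of a-th partial derivatives of the metric
   components; entry (b, k) of [levi_civita a] is the Christoffel symbol with
   upper index k and lower indices a, b. *)
Definition levi_civita (a : 'I_d) : 'M[R]_d :=
  \matrix_(b, c) (2^-1 * \sum_k invmx G c k * (D a k b + D b k a - D k a b)).

Lemma levi_civita_sym a b c : levi_civita a b c = levi_civita b a c.
Proof.
rewrite !mxE; congr (_ * _); apply: eq_bigr => k _.
by rewrite -{2}(Dsym k) mxE; congr (_ * _); rewrite [D a k b + _]addrC.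
Qed.

Lemma levi_civita_lo a b k :
  (levi_civita a *m G) b k = 2^-1 * (D a k b + D b k a - D k a b).
Proof.
have -> : levi_civita a = 2^-1 *: ((\matrix_(k, b) (D a k b + D b k a - D k a
  b))^T *m (invmx G)).
  apply/matrixP => b' c; rewrite !mxE; congr (_ * _); apply: eq_bigr => l _.
  rewrite !mxE mulrC; congr (_ * _).
  by rewrite -[in LHS]Gsym -trmx_inv mxE.
by rewrite -scalemxAl mulmxKV // !mxE.
Qed.

Lemma levi_civita_compat a :
  D a = levi_civita a *m G + G *m (levi_civita a)^T.
Proof.
apply/matrixP => b k; rewrite [RHS]mxE levi_civita_lo.
rewrite -[G *m _]trmxK trmx_mul trmxK Gsym mxE levi_civita_lo.
have DE i j l : D i j l = D i l j by rewrite -{1}(Dsym i) mxE.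
by rewrite (DE a k b) (DE b k a) (DE k a b); field.
Qed.

(** Koszul's argument: with the upper index lowered, compatibility at three permutations of the
    indices and the symmetry of the lower indices can be solved for the symbols. *)
Lemma levi_civita_unique (S : 'I_d -> 'M[R]_d) :
  (forall a b c, S a b c = S b a c) ->
  (forall a, D a = S a *m G + G *m (S a)^T) ->
  forall a, S a = levi_civita a.
Proof.
move=> Ssym Scompat a; pose L a b k := (S a *m G) b k.
have Lsym i j k : L i j k = L j i k.
  by rewrite /L !mxE; apply: eq_bigr => l _; rewrite Ssym.
have DL i j k : D i j k = L i j k + L i k j.
  rewrite Scompat mxE; congr (_ + _).
  by rewrite -[G *m _]trmxK trmx_mul trmxK Gsym mxE.
rewrite -[LHS](mulmxK Gunit) -[RHS](mulmxK Gunit); congr (_ *m _).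
apply/matrixP => b k; rewrite levi_civita_lo -/(L a b k) !DL.
by rewrite (Lsym a k b) (Lsym b k a) (Lsym a b k) (Lsym b a k); field.
Qed.

End LeviCivitaAlgebra.

(** * Contraction with the inverse metric *)

Section Contraction.
Variables (R : realType) (d : nat).
Implicit Types G H P : 'M[R]_d.

(** A double sum, to match the coordinate formulas of the operators; [contractE] gives the trace
    form. *)
Definition contract G H : R := \sum_a \sum_b invmx G a b * H a b.

Lemma contractE G H : contract G H = \tr (invmx G *m H^T).
Proof.
apply: eq_bigr => a _; rewrite mxE; apply: eq_bigr => b _.
by rewrite mxE.
Qed.

Lemma invmx_unique G H : H *m G = 1%:M -> invmx G = H.
Proof.
move=> HG; have [_ uG] := mulmx1_unit HG.
by rewrite -[H](mulmxK uG) HG mul1mx.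
Qed.

(** The inverse metric transforms with the inverse of [P], which cancels under the trace by
    cyclicity. With [P] the Jacobian this is the chart independence of a full contraction. *)
Lemma contract_congr P G H : P \in unitmx -> G \in unitmx ->
  contract (P *m G *m P^T) (P *m H *m P^T) = contract G H.
Proof.
move=> uP uG; have uPT : P^T \in unitmx by rewrite unitmx_tr.
rewrite !contractE (@invmx_unique _ (invmx P^T *m invmx G *m invmx P)).
  by rewrite !trmx_mul trmxK -!mulmxA mulKmx // mxtrace_mulC -!mulmxA mulmxV //
    mulmx1.
by rewrite -!mulmxA mulKmx // mulKmx // mulVmx.
Qed.

End Contraction.

(** * Change of chart *)

Section GaugeTransformation.
Variables (R : realType) (d : nat) (P : 'M[R]_d).
Implicit Types (G H : 'M[R]_d) (C D : 'I_d -> 'M[R]_d).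

(** Both lower indices of [C] are contracted with [P], so its symmetry survives, and [Q] acts on the
    upper index only. In use [D] holds the derivatives of the Jacobian and [Q] its inverse. *)
Lemma gauge_sym (Q : 'M[R]_d) C D : (forall a b c, C a b c = C b a c) ->
  (forall a b c, D a b c = D b a c) -> forall a b c,
  ((P *m (\sum_i P a i *: C i) + D a) *m Q) b c =
  ((P *m (\sum_i P b i *: C i) + D b) *m Q) a c.
Proof.
move=> Csym Dsym a b c; rewrite [LHS]mxE [RHS]mxE.
apply: eq_bigr => l _; congr (_ * _); rewrite [LHS]mxE [RHS]mxE Dsym.
congr (_ + _); rewrite [LHS]mxE [RHS]mxE.
under eq_bigr do rewrite summxE mulr_sumr.
rewrite exchange_big; apply: eq_bigr => i _.
rewrite summxE mulr_sumr; apply: eq_bigr => j _.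
by rewrite !mxE Csym mulrCA.
Qed.

(** The left side is the Leibniz expansion of the derivative of P G P^T when [K] is the derivative
    of [P] and [H] is compatible with [G]; the identity is the metric compatibility of the
    gauge-transformed symbols [S]. *)
Lemma gauge_compat G H K : P \in unitmx ->
  let S := (P *m H + K) *m invmx P in
  K *m G *m P^T + P *m (H *m G + G *m H^T) *m P^T + P *m G *m K^T =
  S *m (P *m G *m P^T) + (P *m G *m P^T) *m S^T.
Proof.
move=> uP; have uPT : P^T \in unitmx by rewrite unitmx_tr.
rewrite /= [((_ + _) *m _)^T]trmx_mul trmx_inv [(_ + K)^T]linearD /= [(P *m
  H)^T]trmx_mul.
rewrite -!mulmxA (mulmxA (invmx P)) mulVmx // mul1mx.
rewrite (mulmxA P^T) mulmxV // mul1mx !(mulmxDl, mulmxDr) !mulmxA.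
by rewrite !addrA; congr (_ + _ + _); rewrite addrC.
Qed.

End GaugeTransformation.

Section Charts.
Variables (R : realType) (d : nat) (M : topologicalType).
Variable X : oriented_manifold R d M.
Implicit Types (e : chart R d M) (y : 'rV[R]_d).

Definition overlap e e' : set 'rV[R]_d := coord e @` (dom e `&` dom e').

Lemma coordVP e y : (coord e @` dom e) y ->
  dom e (coordV e y) /\ coord e (coordV e y) = y.
Proof. by move=> [x ex <-]; rewrite coordK. Qed.

Lemma overlapP e e' y : overlap e e' y ->
  [/\ dom e (coordV e y), dom e' (coordV e y) & coord e (coordV e y) = y].
Proof. by move=> [x [ex e'x] <-]; rewrite coordK. Qed.

Lemma overlapW e e' y : overlap e e' y -> (coord e @` dom e) y.
Proof. by move=> [x [ex _] <-]; exists x. Qed.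

Lemma open_overlap e e' : open (overlap e e').
Proof.
rewrite openE => y oy; have [ex e'x ey] := overlapP oy.
have iy := overlapW oy.
have n1 : nbhs y (coord e @` dom e).
  by apply: open_nbhs_nbhs; split => //; exact: img_open.
have n2 : nbhs y (coordV e @^-1` dom e').
  apply: (coordV_continuous iy); apply: open_nbhs_nbhs; split => //.
  exact: dom_open.
apply: filterS (filterI n1 n2) => z [iz e'z].
by have [ez zE] := coordVP iz; exists (coordV e z).
Qed.

Lemma transitionP e e' y : overlap e e' y ->
  coordV e' (transition e e' y) = coordV e y /\ overlap e' e (transition e e' y).
Proof.
move=> /overlapP[ex e'x ey]; rewrite /transition coordK //; split=> //.
by exists (coordV e y).
Qed.

Lemma transition_smooth e e' j : atlas X e -> atlas X e' ->
  smooth_on (overlap e e') (fun z => transition e e' z 0 j).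
Proof. by move=> eX e'X; exact: (atlas_compatible eX e'X). Qed.

(** The Jacobian as a function of the coordinates with entries given by partial derivatives, so that
    it can be differentiated again. *)
Definition trJ e e' y : 'M[R]_d :=
  \matrix_(i, j) partial i (fun z => transition e e' z 0 j) y.

Lemma trJE e e' y : atlas X e -> atlas X e' -> overlap e e' y ->
  transition_jacobian e e' (coordV e y) = trJ e e' y.
Proof.
move=> eX e'X oy; have [_ _ ey] := overlapP oy.
rewrite /transition_jacobian ey jacobianE // => j.
exact: smooth_on_diff (transition_smooth j eX e'X) oy.
Qed.

Lemma trJ_unit e e' y : atlas X e -> atlas X e' -> overlap e e' y ->
  trJ e e' y \in unitmx.
Proof.
move=> eX e'X oy; have [ex e'x ey] := overlapP oy.
rewrite -trJE // unitmxE unitfE gt_eqF //; exact: (atlas_oriented eX e'X).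
Qed.

Lemma trJ_smooth e e' : atlas X e -> atlas X e' ->
  mx_smooth (overlap e e') (trJ e e').
Proof.
move=> eX e'X i j; under eq_fun do rewrite mxE.
exact/smooth_on_partial/transition_smooth.
Qed.

Lemma dmx_trJ_sym e e' y a b c : atlas X e -> atlas X e' -> overlap e e' y ->
  dmx (trJ e e') a y b c = dmx (trJ e e') b y a c.
Proof.
move=> eX e'X oy.
have JE i : (fun z => trJ e e' z i c) =
    partial i (fun z => transition e e' z 0 c).
  by apply/funext => z; rewrite mxE.
rewrite [LHS]mxE [RHS]mxE !JE.
exact: (smooth_on_partialC _ _ (@open_overlap e e') (transition_smooth c eX e'X)
  oy).
Qed.

Lemma dmx_dmx m n U (A : 'rV[R]_d -> 'M[R]_(m, n)) a b y :
  open U -> mx_smooth U A -> U y ->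
  dmx (dmx A a) b y = dmx (dmx A b) a y.
Proof.
move=> oU sA Uy; apply/matrixP => i j.
have AE k : (fun z => dmx A k z i j) = partial k (fun z => A z i j).
  by apply/funext => z; rewrite mxE.
rewrite [LHS]mxE [RHS]mxE !AE.
exact: (smooth_on_partialC _ _ oU (sA i j) Uy).
Qed.

Lemma dmx_transition m n e e' (A : 'rV[R]_d -> 'M[R]_(m, n)) a y :
  atlas X e -> atlas X e' -> mx_smooth (coord e' @` dom e') A -> overlap e e' y ->
  dmx (fun z => A (transition e e' z)) a y =
  \sum_i trJ e e' y a i *: dmx A i (transition e e' y).
Proof.
move=> eX e'X sA oy; have [_ /overlapW oy'] := transitionP oy.
rewrite (dmx_comp a (fun j => transition_smooth j eX e'X) sA oy oy').
by apply: eq_bigr => i _; rewrite mxE.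
Qed.

Lemma smooth_transition m n e e' (A : 'rV[R]_d -> 'M[R]_(m, n)) :
  atlas X e -> atlas X e' -> mx_smooth (coord e' @` dom e') A ->
  mx_smooth (overlap e e') (fun z => A (transition e e' z)).
Proof.
move=> eX e'X sA i j.
apply: (smooth_on_comp (W := coord e' @` dom e') (f := fun z => A z i j)).
- exact: open_overlap.
- by move=> y /transitionP[_ /overlapW].
- by move=> k; exact: transition_smooth.
- exact: sA.
Qed.

Section Metric.
Variable g : metric R d M.
Hypothesis rg : riemannian X g.

Definition metric_mx e y : 'M[R]_d := g e (coordV e y).

Lemma metric_mx_sym e y : atlas X e -> (coord e @` dom e) y ->
  (metric_mx e y)^T = metric_mx e y.
Proof. by move=> eX /coordVP[ex _]; exact: (metric_sym rg eX ex). Qed.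

Lemma metric_mx_unit e y : atlas X e -> (coord e @` dom e) y ->
  metric_mx e y \in unitmx.
Proof.
move=> eX /coordVP[ex _]; rewrite -row_free_unit -kermx_eq0.
apply/negPn/negP => /rowV0Pn[v /sub_kermxP vG v0].
by have := metric_pos rg eX ex v0; rewrite vG mul0mx mxE ltxx.
Qed.

Lemma metric_mx_smooth e : atlas X e ->
  mx_smooth (coord e @` dom e) (metric_mx e).
Proof. by move=> eX i j; exact: (metric_smooth rg eX). Qed.

Lemma metric_mx_change e e' y : atlas X e -> atlas X e' -> overlap e e' y ->
  metric_mx e y =
  trJ e e' y *m metric_mx e' (transition e e' y) *m (trJ e e' y)^T.
Proof.
move=> eX e'X oy; have [ex e'x _] := overlapP oy.
rewrite /metric_mx (transitionP oy).1 -trJE //; exact: (metric_change rg).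
Qed.

Lemma metric_up_smooth e a b : atlas X e ->
  smooth_on (coord e @` dom e) (metric_up g e a b).
Proof.
move=> eX; apply: (smooth_on_invmx (A := metric_mx e)); first exact: img_open.
- by move=> y; exact: metric_mx_unit.
- exact: metric_mx_smooth.
Qed.

Definition connection e a y : 'M[R]_d :=
  levi_civita (metric_mx e y) (dmx (metric_mx e) ^~ y) a.

Lemma christoffelE e a b c y : christoffel g e c a b y = connection e a y b c.
Proof.
rewrite mxE; congr (_ * _); apply: eq_bigr => k _; congr (_ * (_ + _ - _)).
all: by rewrite mxE.
Qed.

Lemma dmx_metric_sym e a y : atlas X e -> (coord e @` dom e) y ->
  (dmx (metric_mx e) a y)^T = dmx (metric_mx e) a y.
Proof.
move=> eX iy; rewrite -dmx_tr.
apply: dmx_ext (@img_open _ _ _ e) _ iy => z; exact: metric_mx_sym.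
Qed.

Lemma connection_smooth e a : atlas X e ->
  mx_smooth (coord e @` dom e) (connection e a).
Proof.
move=> eX i j; have oU := @img_open _ _ _ e.
under eq_fun do rewrite mxE.
apply: smooth_onM => //; first exact: smooth_on_cst.
apply: smooth_on_sum => // k; apply: smooth_onM => //.
  exact: metric_up_smooth.
have sD b := mx_smooth_dmx b (metric_mx_smooth eX).
by apply: smooth_onB => //; [apply: smooth_onD => //|]; exact: sD.
Qed.

Lemma connection_sym e a b c y : atlas X e -> (coord e @` dom e) y ->
  connection e a y b c = connection e b y a c.
Proof. by move=> eX iy; apply: levi_civita_sym => i; exact: dmx_metric_sym. Qed.

(** Multiplied by the inverse Jacobian, the right side is symmetric in the lower indices and
    compatible with the metric of [e], so [levi_civita_unique] identifies it without expanding any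
    Christoffel symbol. *)
Lemma connection_change e e' a y :
  atlas X e -> atlas X e' -> overlap e e' y ->
  connection e a y *m trJ e e' y =
  trJ e e' y *m (\sum_i trJ e e' y a i *: connection e' i (transition e e' y))
  + dmx (trJ e e') a y.
Proof.
move=> eX e'X oy; have iy := overlapW oy.
have [_ /overlapW iy'] := transitionP oy.
set J := trJ e e'; set P := J y; set y' := transition e e' y.
have uP : P \in unitmx by exact: trJ_unit.
have sJ := trJ_smooth eX e'X.
pose H b := \sum_i P b i *: connection e' i y'.
pose S b := (P *m H b + dmx J b y) *m invmx P.
suff -> : connection e a y = S a by rewrite /S mulmxKV.
apply/esym; apply: (levi_civita_unique _ _ _ _ a).
- exact: metric_mx_unit.
- exact: metric_mx_sym.
- apply: gauge_sym => b c k; first exact: connection_sym.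
  exact: dmx_trJ_sym.
(* [Gphi] is the metric matrix of [e'] in the coordinates of [e]; the chain rule and compatibility
   in [e'] express its derivative through [H]. *)
- move=> b; pose Gphi z := metric_mx e' (transition e e' z).
  have sG' : mx_smooth (overlap e e') Gphi.
    exact/smooth_transition/metric_mx_smooth.
  have dG : dmx Gphi b y = H b *m Gphi y + Gphi y *m (H b)^T.
    rewrite dmx_transition //; last exact: metric_mx_smooth.
    rewrite /H mulmx_suml linear_sum mulmx_sumr -big_split.
    apply: eq_bigr => i _ /=; rewrite linearZ /= -scalemxAl -scalemxAr
      -scalerDr.
    congr (_ *: _); apply: levi_civita_compat.
    + exact: metric_mx_unit.
    + exact: metric_mx_sym.
    + by move=> k; exact: dmx_metric_sym.
  have oU := @open_overlap e e'.
  rewrite (dmx_ext b oU (fun z => metric_mx_change eX e'X (y := z)) oy).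
  rewrite (metric_mx_change eX e'X oy) -/(Gphi _) -/J -/P.
  have sJT : mx_smooth (overlap e e') (fun z => (J z)^T).
    by move=> i j; under eq_fun do rewrite mxE; exact: sJ.
  rewrite (dmxM b (mx_smoothM oU sJ sG') sJT oy).
  rewrite (dmxM b sJ sG' oy) dmx_tr dG -gauge_compat //.
  by rewrite mulmxDl.
Qed.

End Metric.
End Charts.

(** * Curvature under a change of chart *)

Section Curvature.
Variables (R : realType) (d : nat) (M : topologicalType).
Variable X : oriented_manifold R d M.
Implicit Types (e : chart R d M) (y : 'rV[R]_d).
Variable g : metric R d M.
Hypothesis rg : riemannian X g.

(** Entry (b, a) is R^a_{bck}. The products stand in the reverse of the usual order because the
    upper index of a connection matrix is its column. *)
Definition curvature e c k y : 'M[R]_d :=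
  dmx (connection g e k) c y - dmx (connection g e c) k y
  + connection g e k y *m connection g e c y
  - connection g e c y *m connection g e k y.

Lemma riemannE e a b c k y : riemann g e a b c k y = curvature e c k y b a.
Proof.
have CE i j l : christoffel g e i j l = fun z => connection g e j z l i.
  by apply/funext => z; rewrite christoffelE.
rewrite /riemann sumrB addrA !CE !mxE; congr (_ + _ - _).
  by apply: eq_bigr => l _; rewrite !christoffelE mulrC.
by apply: eq_bigr => l _; rewrite !christoffelE mulrC.
Qed.

(* Curvature of a gauge-transformed connection; the second derivatives [S] of
   the gauge cancel. *)
Lemma gauge_curvature (P Gc Gk Hc Hk Dc Dk DcGk DkGc DcHk DkHc S : 'M[R]_d) :
  Gc *m P = P *m Hc + Dc -> Gk *m P = P *m Hk + Dk ->
  DcGk *m P + Gk *m Dc = Dc *m Hk + P *m DcHk + S ->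
  DkGc *m P + Gc *m Dk = Dk *m Hc + P *m DkHc + S ->
  (DcGk - DkGc + Gk *m Gc - Gc *m Gk) *m P =
  P *m (DcHk - DkHc + Hk *m Hc - Hc *m Hk).
Proof.
move=> Ec Ek Eck Ekc.
rewrite !(mulmxDl, mulmxDr, mulNmx, mulmxN) -(mulmxA Gk) -(mulmxA Gc) Ec Ek.
rewrite !mulmxDr !mulmxA Ec Ek !mulmxDl.
move: Eck Ekc; move: (DcGk *m P) (DkGc *m P) (Gk *m Dc) (Gc *m Dk).
move: (Dc *m Hk) (Dk *m Hc) (P *m DcHk) (P *m DkHc) (P *m Hc *m Hk) (P *m Hk *m
  Hc).
move=> A1 A2 A3 A4 A5 A6 A7 A8 A9 A10 /matrixP E1 /matrixP E2.
apply/matrixP => i j; move: (E1 i j) (E2 i j); rewrite !mxE; lra.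
Qed.

Lemma curvature_change e e' c k y : atlas X e -> atlas X e' -> overlap e e' y ->
  curvature e c k y *m trJ e e' y =
  trJ e e' y *m (\sum_i \sum_j (trJ e e' y c j * trJ e e' y k i)
                  *: curvature e' j i (transition e e' y)).
Proof.
move=> eX e'X oy; have iy := overlapW oy.
have [_ /overlapW iy'] := transitionP oy.
have oU := @open_overlap _ _ _ e e'.
pose J := trJ e e'; pose U := overlap e e'.
have sJ : mx_smooth U J := trJ_smooth eX e'X.
pose Gphi i z := connection g e' i (transition e e' z).
have sG i : mx_smooth U (Gphi i).
  by apply: (smooth_transition eX e'X); exact: (connection_smooth rg).
pose H a z := \sum_i J z a i *: Gphi i z.
have sJG a i : mx_smooth U (fun z => J z a i *: Gphi i z).
  move=> p q; under eq_fun do rewrite mxE.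
  exact: smooth_onM oU (sJ a i) (sG i p q).
have sH a : mx_smooth U (H a).
  move=> p q; under eq_fun do rewrite summxE.
  by apply: smooth_on_sum => // i; exact: sJG.
have sC a : mx_smooth U (connection g e a).
  by move=> p q; apply: smooth_on_sub (connection_smooth rg a eX p q) =>
    z /overlapW.
have E a z : U z -> connection g e a z *m J z = J z *m H a z + dmx J a z.
  exact: (connection_change rg).
have DE a b : dmx (connection g e a) b y *m J y + connection g e a y *m dmx J b
  y
    = dmx J b y *m H a y + J y *m dmx (H a) b y + dmx (dmx J a) b y.
  rewrite -(dmxM b (sC a) sJ oy) (dmx_ext b oU (E a) oy).
  rewrite (dmxD _ (mx_smoothM oU sJ (sH a)) (mx_smooth_dmx a sJ) oy).
  by rewrite (dmxM b sJ (sH a) oy).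
(* Exchanging the second derivatives of the Jacobian makes both derivatives of the gauge law share
   the term [S] of [gauge_curvature]. *)
have DEk := DE c k; rewrite (dmx_dmx c k oU sJ oy) in DEk.
rewrite (gauge_curvature (E c y oy) (E k y oy) (DE k c) DEk); congr (_ *m _).
have dH a b : dmx (H a) b y = \sum_i (dmx J b y a i *: Gphi i y
    + \sum_j (J y b j * J y a i) *: dmx (connection g e' i) j (transition e e'
        y)).
  rewrite (dmx_sum _ (sJG a) oy); apply: eq_bigr => i _.
  rewrite (dmxZ _ (sJ a i) (sG i) oy) [dmx J b y a i]mxE.
  congr (_ + _); rewrite /Gphi.
  rewrite (dmx_transition b eX e'X (connection_smooth rg i e'X) oy).
  by rewrite scaler_sumr; apply: eq_bigr => j _; rewrite scalerA mulrC.
have HH a b : H a y *m H b y = \sum_i \sum_j (J y b j * J y a i) *: (Gphi i y *m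
  Gphi j y).
  rewrite mulmx_suml; apply: eq_bigr => i _; rewrite mulmx_sumr.
  by apply: eq_bigr => j _; rewrite -scalemxAl -scalemxAr scalerA mulrC.
rewrite !dH !HH !big_split /=.
(* Where the derivative falls on a Jacobian coefficient, the terms are symmetric in the directions
   [c] and [k] and cancel; what remains is quadratic in [J], hence tensorial. *)
under eq_bigr do rewrite (dmx_trJ_sym _ _ _ eX e'X oy).
rewrite -/J opprD addrACA subrr add0r.
have swap (F : 'I_d -> 'I_d -> 'M[R]_d) :
    \sum_i \sum_j F i j = \sum_i \sum_j F j i by exact: exchange_big.
rewrite (swap (fun i j => (J y k j * J y c i) *: (Gphi i y *m Gphi j y))).
rewrite (swap (fun i j => (J y k j * J y c i) *: dmx (connection g e' i) j _)).
rewrite -sumrB -big_split -sumrB; apply: eq_bigr => i _ /=.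
rewrite -sumrB -big_split -sumrB; apply: eq_bigr => j _ /=.
by rewrite [J y k i * _]mulrC -scalerBr -scalerDr -scalerBr.
Qed.

Definition ricci_mx e y : 'M[R]_d := \matrix_(b, k) ricci g e b k y.

Lemma ricci_mx_change e e' y : atlas X e -> atlas X e' -> overlap e e' y ->
  ricci_mx e y =
  trJ e e' y *m ricci_mx e' (transition e e' y) *m (trJ e e' y)^T.
Proof.
move=> eX e'X oy; have uJ := trJ_unit eX e'X oy.
set J := trJ e e' y in uJ *; set y' := transition e e' y.
(* The curvature of [e'] conjugated by the Jacobian. In the Ricci contraction its column meets a
   factor [J a j] from a form index, which removes the inverse Jacobian. *)
pose N i j := J *m curvature e' j i y' *m invmx J.
have NJ i j b : \sum_a N i j b a * J a j = \sum_l J b l * curvature e' j i y' l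
  j.
  transitivity ((N i j *m J) b j); first by rewrite [RHS]mxE.
  by rewrite /N mulmxKV // mxE.
have RE a k b : curvature e a k y b a =
    \sum_i \sum_j J k i * (N i j b a * J a j).
  rewrite -[curvature e a k y](mulmxK uJ) (curvature_change _ _ eX e'X oy).
  rewrite mulmx_sumr mulmx_suml summxE; apply: eq_bigr => i _.
  rewrite mulmx_sumr mulmx_suml summxE; apply: eq_bigr => j _.
  rewrite -scalemxAr -scalemxAl [LHS]mxE -/J -/y' -/(N i j).
  by rewrite mulrC [J a j * _]mulrC mulrCA.
apply/matrixP => b k; rewrite [LHS]mxE /ricci [RHS]mxE.
under eq_bigr do rewrite riemannE RE.
rewrite exchange_big; apply: eq_bigr => i _ /=.
rewrite exchange_big /= [J^T _ _]mxE [RHS]mulrC [(J *m _) b i]mxE.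
transitivity (J k i * \sum_j \sum_l J b l * curvature e' j i y' l j).
  by rewrite mulr_sumr; apply: eq_bigr => j _; rewrite -mulr_sumr NJ.
congr (_ * _); rewrite exchange_big; apply: eq_bigr => l _ /=.
rewrite -mulr_sumr; congr (_ * _); rewrite mxE.
by apply: eq_bigr => j _; rewrite riemannE.
Qed.

End Curvature.

(** * Gradient and Laplacian *)

Section ContractionLinear.
Variables (R : realType) (d : nat) (G : 'M[R]_d).
Implicit Types H K : 'M[R]_d.

Lemma contractD H K : contract G (H + K) = contract G H + contract G K.
Proof.
rewrite /contract -big_split; apply: eq_bigr => a _; rewrite -big_split.
by apply: eq_bigr => b _ /=; rewrite mxE mulrDr.
Qed.

Lemma contractZ (t : R) H : contract G (t *: H) = t * contract G H.
Proof.
rewrite /contract mulr_sumr; apply: eq_bigr => a _; rewrite mulr_sumr.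
by apply: eq_bigr => b _; rewrite mxE mulrCA.
Qed.

Lemma contract_tr H : G^T = G -> contract G H^T = contract G H.
Proof.
move=> Gsym; rewrite /contract exchange_big; apply: eq_bigr => a _.
apply: eq_bigr => b _; rewrite mxE; congr (_ * _).
by rewrite -[in LHS]Gsym -trmx_inv mxE.
Qed.

End ContractionLinear.

Section Operators.
Variables (R : realType) (d : nat) (M : topologicalType).
Variable g : metric R d M.
Implicit Types (e : chart R d M) (y : 'rV[R]_d) (f h : 'rV[R]_d -> R).

Definition grad_mx f h y : 'M[R]_d :=
  \matrix_(a, b) (partial a f y * partial b h y).

Definition gradprod_coord e f h y : R :=
  contract (metric_mx g e y) (grad_mx f h y).

Definition hessian_mx e f y : 'M[R]_d := \matrix_(a, b) hessian g e f a b y.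

Lemma gradsq_coordE e f y : gradsq_coord g e f y = gradprod_coord e f f y.
Proof.
by apply: eq_bigr => a _; apply: eq_bigr => b _; rewrite mxE mulrA.
Qed.

Lemma laplacian_coordE e f y :
  laplacian_coord g e f y = contract (metric_mx g e y) (hessian_mx e f y).
Proof. by apply: eq_bigr => a _; apply: eq_bigr => b _; rewrite mxE. Qed.

Lemma scalar_coordE e y :
  scalar_coord g e y = contract (metric_mx g e y) (ricci_mx g e y).
Proof. by apply: eq_bigr => a _; apply: eq_bigr => b _; rewrite mxE. Qed.

Section Leibniz.
Variables (e : chart R d M) (U : set 'rV[R]_d) (y : 'rV[R]_d).
Hypotheses (oU : open U) (Uy : U y).
Hypothesis gsym : (metric_mx g e y)^T = metric_mx g e y.

Lemma gradprod_coordC f h : gradprod_coord e f h y = gradprod_coord e h f y.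
Proof.
rewrite /gradprod_coord -contract_tr //; congr (contract _ _).
by apply/matrixP => a b; rewrite !mxE mulrC.
Qed.

Lemma gradprod_combination (s t : R) f h1 h2 k :
  (forall a, partial a f y = s * partial a h1 y + t * partial a h2 y) ->
  gradprod_coord e f k y =
  s * gradprod_coord e h1 k y + t * gradprod_coord e h2 k y.
Proof.
move=> fE; rewrite -!contractZ -contractD; congr (contract _ _).
apply/matrixP => a b; rewrite !mxE fE.
by rewrite mulrDl !mulrA.
Qed.

(** The Christoffel terms are linear in the first derivatives at [y], and a symmetrised product of
    gradients contracts to twice [gradprod_coord]. The rules for sums, products, logarithms and
    constants are all instances. *)
Lemma laplacian_combination (s t r : R) f h1 h2 k1 k2 :
  (forall a, partial a f y = s * partial a h1 y + t * partial a h2 y) ->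
  (forall a b, partial a (partial b f) y =
    s * partial a (partial b h1) y + t * partial a (partial b h2) y
    + r * (partial a k1 y * partial b k2 y + partial a k2 y * partial b k1 y)) ->
  laplacian_coord g e f y = s * laplacian_coord g e h1 y
    + t * laplacian_coord g e h2 y + 2 * r * gradprod_coord e k1 k2 y.
Proof.
move=> f1 f2; rewrite !laplacian_coordE.
have -> : hessian_mx e f y = s *: hessian_mx e h1 y + t *: hessian_mx e h2 y
    + r *: (grad_mx k1 k2 y + grad_mx k2 k1 y).
  apply/matrixP => a b; rewrite !mxE /hessian f2.
  have -> : \sum_c christoffel g e c a b y * partial c f y =
      s * (\sum_c christoffel g e c a b y * partial c h1 y)
      + t * (\sum_c christoffel g e c a b y * partial c h2 y).
    rewrite !mulr_sumr -big_split; apply: eq_bigr => c _ /=.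
    by rewrite f1 mulrDr; congr (_ + _); exact: mulrCA.
  move: (partial a _ y) (partial a _ y) (partial a _ y) (partial a _ y).
  move: (partial b _ y) (partial b _ y) (\sum_c _) (\sum_c _) => *; ring.
rewrite !contractD !contractZ contractD -!/(gradprod_coord e _ _ y).
rewrite (gradprod_coordC k2) -mulr2n mulrnAr -mulrnAl -mulr_natl.
by congr (_ + _ + _ * _); exact: mulrC.
Qed.

Lemma gradprodD f h k : smooth_on U f -> smooth_on U h ->
  gradprod_coord e (fun z => f z + h z) k y =
  gradprod_coord e f k y + gradprod_coord e h k y.
Proof.
move=> sf sh; rewrite -[X in X + _]mul1r -[X in _ + X]mul1r.
apply: gradprod_combination => a; rewrite partialD ?mul1r //.
  exact: smooth_on_diff sf Uy.
exact: smooth_on_diff sh Uy.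
Qed.

Lemma gradprodM f h k : smooth_on U f -> smooth_on U h ->
  gradprod_coord e (fun z => f z * h z) k y =
  f y * gradprod_coord e h k y + h y * gradprod_coord e f k y.
Proof.
move=> sf sh; apply: gradprod_combination => a; apply: partialM.
  exact: smooth_on_diff sf Uy.
exact: smooth_on_diff sh Uy.
Qed.

Lemma partial_partial_ext f h b : (forall z, U z -> partial b f z = h z) ->
  forall a, partial a (partial b f) y = partial a h y.
Proof.
move=> fh a; apply: partial_ext.
by apply: filterS (open_nbhs_nbhs (conj oU Uy)) => z /fh.
Qed.

Lemma laplacianD f h : smooth_on U f -> smooth_on U h ->
  laplacian_coord g e (fun z => f z + h z) y =
  laplacian_coord g e f y + laplacian_coord g e h y.
Proof.
move=> sf sh; have df z Uz := smooth_on_diff (y := z) sf Uz.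
have dh z Uz := smooth_on_diff (y := z) sh Uz.
have d2f b := smooth_on_diff (smooth_on_partial b sf) Uy.
have d2h b := smooth_on_diff (smooth_on_partial b sh) Uy.
rewrite (@laplacian_combination 1 1 0 _ f h f h).
- by rewrite !mul1r mulr0 mul0r addr0.
- by move=> a; rewrite (partialD a (df _ Uy) (dh _ Uy)) !mul1r.
move=> a b; rewrite (partial_partial_ext (h := fun z =>
  partial b f z + partial b h z)).
  rewrite (partialD a (d2f b) (d2h b)).
  move: (partial a (partial b f) y) (partial a (partial b h) y).
  by move: (_ + _ * _) => t p q; rewrite !mul1r mul0r addr0.
by move=> z Uz; rewrite (partialD b (df _ Uz) (dh _ Uz)).
Qed.

Lemma laplacianM f h : smooth_on U f -> smooth_on U h ->
  laplacian_coord g e (fun z => f z * h z) y =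
  f y * laplacian_coord g e h y + h y * laplacian_coord g e f y
  + 2 * gradprod_coord e f h y.
Proof.
move=> sf sh; have df z Uz := smooth_on_diff (y := z) sf Uz.
have dh z Uz := smooth_on_diff (y := z) sh Uz.
have d2f b := smooth_on_diff (smooth_on_partial b sf) Uy.
have d2h b := smooth_on_diff (smooth_on_partial b sh) Uy.
rewrite (@laplacian_combination (f y) (h y) 1 _ h f f h).
- by rewrite mulr1.
- by move=> a; rewrite (partialM a (df _ Uy) (dh _ Uy)).
move=> a b; rewrite (partial_partial_ext
    (h := fun z => f z * partial b h z + h z * partial b f z)).
  rewrite (partialD a (differentiableM (df _ Uy) (d2h b))
    (differentiableM (dh _ Uy) (d2f b))).
  rewrite (partialM a (df _ Uy) (d2h b)) (partialM a (dh _ Uy) (d2f b)).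
  move: (partial a (partial b f) y) (partial a (partial b h) y).
  move: (partial a f y) (partial a h y) (partial b f y) (partial b h y) (f y) (h
    y).
  by move=> *; ring.
by move=> z Uz; rewrite (partialM b (df _ Uz) (dh _ Uz)).
Qed.

Lemma gradprod_ln f k : smooth_on U f -> f y != 0 ->
  gradprod_coord e (fun z => ln `|f z|) k y = gradprod_coord e f k y / f y.
Proof.
move=> sf f0; rewrite (@gradprod_combination (f y)^-1 0 _ f f).
  by rewrite mul0r addr0 mulrC.
by move=> a; rewrite (is_diff_ln_norm oU sf Uy f0).2 mul0r addr0 mulrC.
Qed.

Lemma laplacian_ln f : smooth_on U f -> (forall z, U z -> f z != 0) ->
  laplacian_coord g e (fun z => ln `|f z|) y =
  laplacian_coord g e f y / f y - gradprod_coord e f f y / f y ^+ 2.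
Proof.
move=> sf f0; have df := smooth_on_diff sf Uy.
have d2f b := smooth_on_diff (smooth_on_partial b sf) Uy.
(* The symmetrised product counts the square of the gradient of [f] twice, whence the 2 in the third
   coefficient. *)
rewrite (@laplacian_combination (f y)^-1 0 (- (2 * f y ^+ 2)^-1) _ f f f f).
- move: (laplacian_coord _ _ _ _) (gradprod_coord _ _ _ _) (f y) (f0 _ Uy).
  by move=> l p s s0; field.
- by move=> a; rewrite (is_diff_ln_norm oU sf Uy (f0 _ Uy)).2 mul0r addr0 mulrC.
move=> a b; rewrite (partial_partial_ext (h := fun z => partial b f z / f z)).
  rewrite (partialM a (d2f b) (differentiableV df (f0 _ Uy))).
  rewrite (partialV a df (f0 _ Uy)).
  move: (partial a _ y) (partial a _ y) (partial b _ y) (f y) (f0 _ Uy).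
  by move=> p q r s s0; field.
by move=> z Uz; rewrite (is_diff_ln_norm oU sf Uz (f0 _ Uz)).2.
Qed.

End Leibniz.
End Operators.

(** * Chart independence and smoothness of gradient products, Laplacian and scalar curvature *)

Section Invariance.
Variables (R : realType) (d : nat) (M : topologicalType).
Variable X : oriented_manifold R d M.
Implicit Types (e : chart R d M) (y : 'rV[R]_d) (u v : M -> R).

Lemma local_rep_transition e e' u y : overlap e e' y ->
  local_rep e u y = local_rep e' u (transition e e' y).
Proof. by move=> oy; rewrite /local_rep (transitionP oy).1. Qed.

Lemma chart_atP x : atlas X (chart_at X x) /\ dom (chart_at X x) x.
Proof.
by split; [exact: (s2valP (cid2 (atlas_cover X x)))
          |exact: (s2valP' (cid2 (atlas_cover X x)))].
Qed.

(** The choice [chart_at x] has no regularity in [x]; agreement on overlaps replaces it near a point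
    by one fixed chart. *)
Lemma smooth_of_charts (F : chart R d M -> 'rV[R]_d -> R) :
  (forall e, atlas X e -> smooth_on (coord e @` dom e) (F e)) ->
  (forall e e' y, atlas X e -> atlas X e' -> overlap e e' y ->
     F e y = F e' (transition e e' y)) ->
  smooth X (fun x => F (chart_at X x) (coord (chart_at X x) x)).
Proof.
move=> sF FE e eX; apply: smooth_on_ext (sF e eX); first exact: img_open.
move=> y iy; have [ex ey] := coordVP iy; rewrite /local_rep.
have [e'X e'x] := chart_atP (coordV e y).
by rewrite (FE e (chart_at X (coordV e y))) //; exists (coordV e y).
Qed.

Definition dcol (f : 'rV[R]_d -> R) y : 'cV[R]_d := \col_k partial k f y.

Lemma dcol_transition e e' u y : atlas X e -> atlas X e' -> smooth X u ->
  overlap e e' y ->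
  dcol (local_rep e u) y =
  trJ e e' y *m dcol (local_rep e' u) (transition e e' y).
Proof.
move=> eX e'X su oy; have oU := @open_overlap _ _ _ e e'.
have [_ /overlapW iy'] := transitionP oy.
apply/matrixP => a j; rewrite [LHS]mxE [RHS]mxE.
rewrite (@partial_ext _ _ a _ (fun z => local_rep e' u (transition e e' z))).
  rewrite partial_comp.
  - by apply: eq_bigr => k _; rewrite [trJ _ _ _ _ _]mxE [dcol _ _ _ _]mxE.
  - by move=> k; exact: smooth_on_diff (transition_smooth k eX e'X) oy.
  - exact: smooth_on_diff (su e' e'X) iy'.
apply: filterS (open_nbhs_nbhs (conj oU oy)) => z.
exact: local_rep_transition.
Qed.

Lemma dcol_smooth e u : atlas X e -> smooth X u ->
  mx_smooth (coord e @` dom e) (dcol (local_rep e u)).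
Proof.
by move=> eX su i j; under eq_fun do rewrite mxE; exact/smooth_on_partial/su.
Qed.

Variable g : metric R d M.
Hypothesis rg : riemannian X g.

Lemma hessian_mxE e f y a b : hessian_mx g e f y a b =
  (dmx (dcol f) a y - connection g e a y *m dcol f y) b 0.
Proof.
rewrite [LHS]mxE /hessian [RHS]mxE; congr (_ + _).
  rewrite mxE; congr (partial a _ y).
  by apply/funext => z; rewrite mxE.
rewrite mxE [(_ *m _) b 0]mxE; congr (- _); apply: eq_bigr => c _.
by rewrite christoffelE [dcol _ _ _ _]mxE.
Qed.

(** In each row the inhomogeneous term of [connection_change] cancels the derivative of the Jacobian
    produced by differentiating the chain rule. *)
Lemma hessian_mx_change e e' u y : atlas X e -> atlas X e' -> smooth X u ->
  overlap e e' y ->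
  hessian_mx g e (local_rep e u) y =
  trJ e e' y *m hessian_mx g e' (local_rep e' u) (transition e e' y)
  *m (trJ e e' y)^T.
Proof.
move=> eX e'X su oy; have oU := @open_overlap _ _ _ e e'.
set J := trJ e e' y; set y' := transition e e' y.
pose f := local_rep e u; pose f' := local_rep e' u.
have E a : dmx (dcol f) a y - connection g e a y *m dcol f y =
    J *m \sum_i J a i *: (dmx (dcol f') i y' - connection g e' i y' *m dcol f'
      y').
  have sJ := trJ_smooth eX e'X.
  have sf' := smooth_transition eX e'X (dcol_smooth e'X su).
  rewrite (dmx_ext a oU (fun z => dcol_transition eX e'X su (y := z)) oy).
  rewrite (dmxM a sJ sf' oy) (dcol_transition eX e'X su oy) mulmxA.
  rewrite (connection_change rg a eX e'X oy) -/J -/y' -/f'.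
  rewrite (dmx_transition a eX e'X (dcol_smooth e'X su) oy) -/J -/y' -/f'.
  rewrite mulmxDl [X in X - _]addrC opprD addrACA subrr addr0.
  rewrite -mulmxA -mulmxBr; congr (_ *m _).
  rewrite mulmx_suml -sumrB; apply: eq_bigr => i _.
  by rewrite -scalemxAl scalerBr.
apply/matrixP => a b; rewrite hessian_mxE E [LHS]mxE [RHS]mxE.
under [RHS]eq_bigr do rewrite mxE [J^T _ _]mxE mulr_suml.
apply: eq_bigr => l _; rewrite summxE mulr_sumr; apply: eq_bigr => i _.
by rewrite hessian_mxE [X in _ * X = _]mxE [LHS]mulrC.
Qed.

Definition gradprod u v : M -> R := fun x =>
  let e := chart_at X x in
  gradprod_coord g e (local_rep e u) (local_rep e v) (coord e x).

Lemma grad_mx_change e e' u v y : atlas X e -> atlas X e' ->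
  smooth X u -> smooth X v -> overlap e e' y ->
  grad_mx (local_rep e u) (local_rep e v) y =
  trJ e e' y *m grad_mx (local_rep e' u) (local_rep e' v) (transition e e' y)
  *m (trJ e e' y)^T.
Proof.
move=> eX e'X su sv oy.
have E f h z : grad_mx f h z = dcol f z *m (dcol h z)^T.
  apply/matrixP => a b; rewrite [LHS]mxE [RHS]mxE big_ord1.
  by rewrite [dcol f _ _ _]mxE mxE [dcol h _ _ _]mxE.
rewrite !E (dcol_transition eX e'X su oy) (dcol_transition eX e'X sv oy).
by rewrite trmx_mul !mulmxA.
Qed.

Lemma contract_transition e e' y (H H' : 'M[R]_d) :
  atlas X e -> atlas X e' -> overlap e e' y ->
  H = trJ e e' y *m H' *m (trJ e e' y)^T ->
  contract (metric_mx g e y) H =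
  contract (metric_mx g e' (transition e e' y)) H'.
Proof.
move=> eX e'X oy ->; rewrite (metric_mx_change rg eX e'X oy).
have [_ /overlapW iy'] := transitionP oy.
by rewrite contract_congr // ?(trJ_unit eX e'X oy) ?(metric_mx_unit rg e'X iy').
Qed.

Lemma grad_partial_smooth e u a : atlas X e -> smooth X u ->
  smooth_on (coord e @` dom e) (partial a (local_rep e u)).
Proof. by move=> eX su; exact/smooth_on_partial/su. Qed.

Lemma smooth_on_contract e (H : 'rV[R]_d -> 'M[R]_d) : atlas X e ->
  mx_smooth (coord e @` dom e) H ->
  smooth_on (coord e @` dom e) (fun y => contract (metric_mx g e y) (H y)).
Proof.
move=> eX sH; have oU := @img_open _ _ _ e.
apply: smooth_on_sum => // a; apply: smooth_on_sum => // b.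
exact: smooth_onM oU (metric_up_smooth rg a b eX) (sH a b).
Qed.

Lemma smooth_gradprod u v : smooth X u -> smooth X v -> smooth X (gradprod u v).
Proof.
move=> su sv; apply: (smooth_of_charts (F := fun e =>
  gradprod_coord g e (local_rep e u) (local_rep e v))) =>
    [e eX|e e' y eX e'X oy].
  apply: smooth_on_contract => // a b; under eq_fun do rewrite mxE.
  apply: smooth_onM; first exact: img_open.
    exact: grad_partial_smooth.
  exact: grad_partial_smooth.
exact/contract_transition/grad_mx_change.
Qed.

Lemma christoffel_smooth e a b c : atlas X e ->
  smooth_on (coord e @` dom e) (christoffel g e c a b).
Proof.
move=> eX.
have -> : christoffel g e c a b = fun z => connection g e a z b c.
  by apply/funext => z; rewrite christoffelE.
exact: (connection_smooth rg).
Qed.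

Lemma smooth_laplacian u : smooth X u -> smooth X (laplacian X g u).
Proof.
move=> su; rewrite /laplacian.
apply: (smooth_of_charts (F := fun e => laplacian_coord g e (local_rep e u)))
  => [e eX|e e' y eX e'X oy].
  have oU := @img_open _ _ _ e.
  have -> : laplacian_coord g e (local_rep e u) = fun z =>
      contract (metric_mx g e z) (hessian_mx g e (local_rep e u) z).
    by apply/funext => z; exact: laplacian_coordE.
  apply: smooth_on_contract => // a b; under eq_fun do rewrite mxE.
  apply: smooth_onB => //.
    exact/smooth_on_partial/grad_partial_smooth.
  apply: smooth_on_sum => // k; apply: smooth_onM => //.
    exact: christoffel_smooth.
  exact: grad_partial_smooth.
by rewrite !laplacian_coordE; exact/contract_transition/hessian_mx_change.
Qed.

Lemma smooth_Jcurv : smooth X (Jcurv X g).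
Proof.
have sSc : smooth X (Sc X g).
  rewrite /Sc; apply: (smooth_of_charts (F := fun e => scalar_coord g e))
    => [e eX|e e' y eX e'X oy].
    have oU := @img_open _ _ _ e.
    have -> : scalar_coord g e = fun z =>
        contract (metric_mx g e z) (ricci_mx g e z).
      by apply/funext => z; exact: scalar_coordE.
    apply: smooth_on_contract => // b k; under eq_fun do rewrite mxE.
    have sG a b' c := @christoffel_smooth e a b' c eX.
    apply: smooth_on_sum => // a; apply: smooth_onD => //.
      by apply: smooth_onB => //; apply: smooth_on_partial.
    by apply: smooth_on_sum => // l; apply: smooth_onB => //; apply: smooth_onM.
  by rewrite !scalar_coordE; exact/contract_transition/(ricci_mx_change rg).
move=> e eX; apply: smooth_onM; first exact: img_open.
  exact: sSc.
exact: smooth_on_cst.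
Qed.

End Invariance.

Section SmoothAlgebra.
Variables (R : realType) (d : nat) (M : topologicalType).
Variable X : oriented_manifold R d M.
Implicit Types u v : M -> R.

Lemma smoothD u v : smooth X u -> smooth X v -> smooth X (fun x => u x + v x).
Proof.
by move=> su sv e eX; apply: smooth_onD (su e eX) (sv e eX); exact: img_open.
Qed.

Lemma smoothM u v : smooth X u -> smooth X v -> smooth X (fun x => u x * v x).
Proof.
by move=> su sv e eX; apply: smooth_onM (su e eX) (sv e eX); exact: img_open.
Qed.

Lemma smooth_cst (a : R) : smooth X (fun=> a).
Proof. by move=> e _; exact: smooth_on_cst. Qed.

Lemma smoothX u n : smooth X u -> smooth X (fun x => u x ^+ n).
Proof. by move=> su e eX; apply: smooth_onX (su e eX); exact: img_open. Qed.

Lemma smoothV u : (forall x, u x != 0) -> smooth X u ->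
  smooth X (fun x => (u x)^-1).
Proof.
move=> u0 su e eX; apply: smooth_onV (su e eX); first exact: img_open.
by move=> y _; exact: u0.
Qed.

Lemma smooth_norm u : (forall x, u x != 0) -> smooth X u ->
  smooth X (fun x => `|u x|).
Proof.
move=> u0 su e eX; apply: smooth_on_norm (su e eX); first exact: img_open.
by move=> y _; exact: u0.
Qed.

End SmoothAlgebra.

(** * Conformal rescaling *)

Section RescaledChristoffel.
Variables (R : realType) (d : nat).

Lemma invmx_scale (t : R) (G : 'M[R]_d) : t != 0 -> G \in unitmx ->
  invmx (t *: G) = t^-1 *: invmx G.
Proof.
move=> t0 uG; apply: invmx_unique.
by rewrite -scalemxAr -scalemxAl mulVmx // scalerA mulfV ?scale1r.
Qed.

Lemma levi_civita_rescaled (G : 'M[R]_d) (D : 'I_d -> 'M[R]_d) (w : R)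
    (p : 'I_d -> R) (a b c : 'I_d) : G \in unitmx -> w != 0 ->
  levi_civita (w ^+ 2 *: G)
    (fun i => (2 * w * p i) *: G + w ^+ 2 *: D i) a b c =
  levi_civita G D a b c + w^-1 * (p a * (c == b)%:R + p b * (c == a)%:R
    - G a b * \sum_k invmx G c k * p k).
Proof.
(* Writing the Kronecker deltas as inverse metric times metric turns both sides into sums over [k]
   that agree term by term. *)
move=> uG w0; have K i j : (i == j)%:R = \sum_k invmx G i k * G k j.
  by have /matrixP/(_ i j) := mulVmx uG; rewrite !mxE.
have w20 : w ^+ 2 != 0 by rewrite expf_neq0.
rewrite (K c b) (K c a) !mulr_sumr -big_split -sumrB /= mulr_sumr.
rewrite [LHS]mxE (invmx_scale w20 uG) [levi_civita G D a b c]mxE !mulr_sumr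
  -big_split; apply: eq_bigr => k _ /=.
rewrite !mxE.
move: (invmx G c k) (G k a) (G k b) (G a b) (D a k b) (D b k a) (D k a b).
by move: (p a) (p b) (p k) => *; field.
Qed.

Lemma christoffel_correction (Gam q V : 'I_d -> R)
    (t pa pb Gab : R) (a b : 'I_d) :
  \sum_c (Gam c + t * (pa * (c == b)%:R + pb * (c == a)%:R - Gab * V c)) * q c =
  \sum_c Gam c * q c + t * (pa * q b + pb * q a - Gab * \sum_c V c * q c).
Proof.
have S i : q i = \sum_c (c == i)%:R * q c.
  rewrite (bigD1 i) //= eqxx mul1r big1 ?addr0 // => c /negbTE ->.
  by rewrite mul0r.
rewrite (S a) (S b) !mulr_sumr -big_split -sumrB mulr_sumr -big_split.
by apply: eq_bigr => c _ /=; ring.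
Qed.

End RescaledChristoffel.

Section Rescaling.
Variables (R : realType) (d : nat) (M : topologicalType).
Variable X : oriented_manifold R d M.
Variables (g g' : metric R d M) (Omega : M -> R).
Hypotheses (rg : riemannian X g) (gg' : rescaled X Omega g g').

Lemma riemannian_rescaled : riemannian X g'.
Proof.
have [sO O0 gE] := gg'; split.
- by move=> e x eX ex; rewrite gE // linearZ /= (metric_sym rg).
- move=> e x eX ex v v0; rewrite gE // -scalemxAr -scalemxAl mxE.
  by rewrite mulr_gt0 ?exprn_gt0 ?O0 // (metric_pos rg).
- move=> e eX a b; have oU := @img_open _ _ _ e.
  apply: (smooth_on_ext oU _ (smooth_onM oU (smooth_onX 2 oU (sO e eX))
    (metric_smooth rg eX a b))).
  by move=> y /coordVP[ex _]; rewrite /local_rep gE // mxE.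
- move=> e e' eX e'X x ex e'x; rewrite !gE // (metric_change rg eX e'X) //.
  by rewrite -scalemxAr -scalemxAl.
Qed.

Variables (e : chart R d M) (eX : atlas X e) (y : 'rV[R]_d).
Hypothesis iy : (coord e @` dom e) y.

Let omega := local_rep e Omega.
Let G := metric_mx g e y.
Let w := omega y.

Let omega_gt0 : 0 < w.
Proof. by have [_ + _] := gg'; exact. Qed.

Let omega_neq0 : w != 0. Proof. by rewrite gt_eqF. Qed.

Let Gunit : G \in unitmx. Proof. exact: (metric_mx_unit rg eX iy). Qed.

Let Gsym : G^T = G. Proof. exact: (metric_mx_sym rg eX iy). Qed.

Lemma metric_mx_rescaled z : (coord e @` dom e) z ->
  metric_mx g' e z = omega z ^+ 2 *: metric_mx g e z.
Proof. by have [_ _ gE] := gg'; move=> /coordVP[ez _]; exact: gE. Qed.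

Lemma contract_rescaled H :
  contract (metric_mx g' e y) H = w ^- 2 * contract G H.
Proof.
rewrite /contract (metric_mx_rescaled iy) (invmx_scale _ Gunit) ?expf_neq0 //.
rewrite mulr_sumr; apply: eq_bigr => a _.
rewrite mulr_sumr; apply: eq_bigr => b _.
by rewrite mxE mulrA.
Qed.

Lemma christoffel_rescaled a b c :
  christoffel g' e c a b y = christoffel g e c a b y
  + w^-1 * (partial a omega y * (c == b)%:R + partial b omega y * (c == a)%:R
            - G a b * \sum_k invmx G c k * partial k omega y).
Proof.
have oU := @img_open _ _ _ e.
have so : smooth_on (coord e @` dom e) omega by have [sO _ _] := gg'; exact: sO.
have sG := metric_mx_smooth rg eX.
have dO := smooth_on_diff so iy.
have D' i : dmx (metric_mx g' e) i y =
    (2 * w * partial i omega y) *: G + w ^+ 2 *: dmx (metric_mx g e) i y.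
  rewrite (dmx_ext i oU metric_mx_rescaled iy).
  rewrite (dmxZ i (smooth_onX 2 oU so) sG iy); congr (_ *: _ + _).
  rewrite (_ : (fun z => omega z ^+ 2) = fun z => omega z * omega z) //.
  by rewrite (partialM i dO dO) -mulrDl; congr (_ * _); rewrite mulr_natl.
rewrite !christoffelE /connection (metric_mx_rescaled iy).
rewrite (_ : dmx _ ^~ y = fun i => (2 * w * partial i omega y) *: G
                          + w ^+ 2 *: dmx (metric_mx g e) i y).
  exact: levi_civita_rescaled.
by apply/funext => i; exact: D'.
Qed.

Lemma laplacian_rescaled f : 
  laplacian_coord g' e f y = w ^- 2 * (laplacian_coord g e f y
    + (d%:R - 2) / w * gradprod_coord g e omega f y).
Proof.
rewrite !laplacian_coordE contract_rescaled; congr (_ * _).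
have -> : hessian_mx g' e f y = hessian_mx g e f y
    + (- w^-1) *: (grad_mx omega f y + grad_mx f omega y)
    + (w^-1 * gradprod_coord g e omega f y) *: G.
  apply/matrixP => a b; rewrite !mxE /hessian.
  under eq_bigr do rewrite christoffel_rescaled.
  rewrite christoffel_correction.
  have -> : \sum_c (\sum_k invmx G c k * partial k omega y) * partial c f y =
      gradprod_coord g e omega f y.
    rewrite (gradprod_coordC Gsym); apply: eq_bigr => c _; rewrite mulr_suml.
    by apply: eq_bigr => k _; rewrite mxE -mulrA [_ * partial c f y]mulrC.
  move: (gradprod_coord _ _ _ _ _) (\sum_c _) (partial a (partial b f) y).
  move: (partial a _ y) (partial a _ y) (partial b _ y) (partial b _ y) (G a b).
  by move=> *; ring.
(* The trace d of the metric and the two gradient products, with opposite signs, combine to the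
   factor d - 2. *)
have GG : contract G G = d%:R.
  by rewrite contractE Gsym mulVmx // mxtrace1.
rewrite !contractD !contractZ contractD GG.
rewrite -/(gradprod_coord g e omega f y) -/(gradprod_coord g e f omega y).
rewrite (gradprod_coordC Gsym f).
by move: (gradprod_coord _ _ _ _ _) (contract _ _) => *; ring.
Qed.

Definition isq_coord (h : metric R d M) (j : R) f : R :=
  gradsq_coord h e f y
  - 2 / d%:R * f y * (laplacian_coord h e f y + j * f y).

(* The terms linear in the gradient of [f] cancel: weight 1 is the conformal
   weight for which I^2 is invariant up to a zeroth order term, and the
   curvature term [j'] only contributes to the latter. *)
Lemma isq_coord_rescaled (hd : (0 < d)%N) (j j' : R) : exists W, forall U f,
  open U -> U y -> smooth_on U f ->
  (forall z, U z -> (coord e @` dom e) z) ->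
  isq_coord g' j' (fun z => omega z * f z) = isq_coord g j f + f y ^+ 2 * W.
Proof.
have so : smooth_on (coord e @` dom e) omega by have [sO _ _] := gg'; exact: sO.
pose pw := gradprod_coord g e omega omega y.
pose lw := laplacian_coord g e omega y.
(* This value is forced by the constant function [f = 1]. *)
exists (pw / w ^+ 2 - 2 / d%:R * (lw / w + (d%:R - 2) * pw / w ^+ 2)
  + 2 / d%:R * (j - w ^+ 2 * j')) => U f oU Uy sf Ui.
have soU : smooth_on U omega := smooth_on_sub Ui so.
have GP k h : gradprod_coord g' e k h y = w ^- 2 * gradprod_coord g e k h y.
  exact: contract_rescaled.
have GM k : gradprod_coord g e (fun z => omega z * f z) k y =
    w * gradprod_coord g e f k y + f y * gradprod_coord g e omega k y.
  exact: (gradprodM g e Uy k soU sf).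
rewrite /isq_coord !gradsq_coordE laplacian_rescaled GP.
rewrite (laplacianM oU Uy Gsym soU sf) GM.
rewrite (gradprod_coordC Gsym f (fun z =>
  _)) (gradprod_coordC Gsym omega (fun z => _)).
rewrite !GM (gradprod_coordC Gsym f omega) -/pw -/lw -/w.
have d0 : d%:R != 0 :> R by rewrite pnatr_eq0 -lt0n.
move: (gradprod_coord _ _ _ _ _) (gradprod_coord _ _ _ _ _) => p q.
move: (laplacian_coord _ _ _ _) (f y) w omega_neq0 (d%:R) d0 => l s t t0 n n0.
by field; rewrite n0 t0.
Qed.

End Rescaling.

(** * Expansion of the tractor norm *)

Section Expansion.
Variable R : realType.

(* The coefficients of sigma^(d+1) log |sigma|, sigma^(d+1) and
   sigma^(2d) (log |sigma|)^2 in I^2 of sigma' when |tau| = 1.  Here N, s, T, b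
   stand for d, sigma, sigma^(d-1), B; P, r, q for |grad sigma|^2,
   <grad sigma, grad B>, |grad B|^2; D, E for the Laplacians of sigma and B; and
   j for J. *)
Definition coefA (N s T b P r D E j : R) : R :=
  N / 2 / (N + 1) *
    (2 * r - 2 / N * (s * E + (N + 2) * b * D + 2 * (N + 1) * r
                      + 2 * j * s * b))
  + (N / 2 / (N + 1)) ^+ 2 * T * b *
    ((2 - 4 / N) * (s * r + (N + 1) * b * P) - 2 / N * (s * b * D - b * P)).

Definition coefB (N s T b P r D j : R) : R :=
  - (T * b ^+ 2) - 2 / N * b * (D + j * s)
  - N / 2 / (N + 1) * (2 / N) * (b * D + 2 * r)
  + (N / 2 / (N + 1)) ^+ 2 * T * b ^+ 2 * P.

Definition coefC (N s b P r q D E j : R) : R :=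
  (N / 2 / (N + 1)) ^+ 2 *
    (s ^+ 2 * q + 2 * (N + 1) * s * b * r + (N + 1) ^+ 2 * b ^+ 2 * P
     - 2 / N * b * (s ^+ 2 * E + (N + 1) * s * b * D + (N + 1) * N * b * P
                    + 2 * (N + 1) * s * r + j * s ^+ 2 * b)).

(** Powers with a symbolic exponent are hidden from [field] by the atom [T] = s^(d-1): s^d is
    [s * T] and s^(d+1) is [s * (s * T)]. Here [l] is log |s|, [w] is s^(d+1) b and u is [l * w];
    two-letter names are inner products of gradients, except [dw] and [du], which are Laplacians. *)
Lemma expansion_identity (N s T b l P r q D E j : R) :
  s != 0 -> N != 0 -> N + 1 != 0 ->
  P - 2 / N * s * (D + j * s) = 1 + s * T * b ->
  let k := N / 2 / (N + 1) in
  let w := s * (s * T) * b in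
  let sw := s * (s * T) * r + b * ((N + 1) * (s * T) * P) in
  let ww := s * (s * T) * (s * (s * T) * q + b * ((N + 1) * (s * T) * r))
    + b * ((N + 1) * (s * T) * sw) in
  let dw := s * (s * T) * E
    + b * ((N + 1) * (s * T) * (D + N * P / s)) + 2 * ((N + 1) * (s * T) * r) in
  let du := l * dw + w * (D / s - P / s ^+ 2) + 2 * (sw / s) in
  let su := l * sw + w * (P / s) in
  let uu := l * (l * ww + w * (sw / s)) + w * (l * (sw / s) + w * (P / s / s)) in
  (P + k * su) + k * (su + k * uu)
    - 2 / N * (s + k * (l * w)) * (D + k * du + j * (s + k * (l * w)))
  = 1 + s * (s * T) * (l * coefA N s T b P r D E j + coefB N s T b P r D j)
    + (s * T) ^+ 2 * l ^+ 2 * coefC N s b P r q D E j.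
Proof.
move=> s0 N0 N1 HP.
(* Eliminating [P] by the unit condition turns the order s^d remainder into terms of order s^(d+1);
   the rest is an identity of rational functions. *)
have -> : P = 1 + s * T * b + 2 / N * s * (D + j * s) by rewrite -HP subrK.
rewrite /coefA /coefB /coefC; cbv zeta; field.
by rewrite N1 N0 s0.
Qed.

End Expansion.

Section ImprovedInChart.
Variables (R : realType) (d : nat) (M : topologicalType).
Variables (g : metric R d M) (e : chart R d M).
Variables (U : set 'rV[R]_d) (y : 'rV[R]_d).
Hypotheses (oU : open U) (Uy : U y).
Hypothesis gsym : (metric_mx g e y)^T = metric_mx g e y.
Implicit Types f h k s b : 'rV[R]_d -> R.

Local Notation "<| f , h |>" := (gradprod_coord g e f h y).
Local Notation lap f := (laplacian_coord g e f y).

Lemma gradprod_cst (t : R) h : <| fun=> t, h |> = 0.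
Proof.
rewrite (@gradprod_combination _ _ _ g e y 0 0 _ h h);
  first by rewrite !mul0r addr0.
by move=> a; rewrite partial_cst !mul0r addr0.
Qed.

Lemma laplacian_cst (t : R) : lap (fun=> t) = 0.
Proof.
pose c : 'rV[R]_d -> R := fun=> t.
rewrite (@laplacian_combination _ _ _ g e y gsym 0 0 0 _ c c c c).
- by rewrite mulr0 !mul0r !addr0.
- by move=> a; rewrite partial_cst !mul0r addr0.
move=> a b; rewrite (partial_partial_ext oU Uy (h := fun=> 0)).
  by rewrite partial_cst !mul0r !addr0.
by move=> z _; rewrite partial_cst.
Qed.

Lemma gradprodZ (t : R) f h : smooth_on U f ->
  <| fun z => t * f z, h |> = t * <| f, h |>.
Proof.
move=> sf; rewrite (gradprodM g e Uy h (smooth_on_cst U t) sf).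
by rewrite gradprod_cst mulr0 addr0.
Qed.

Lemma laplacianZ (t : R) f : smooth_on U f ->
  lap (fun z => t * f z) = t * lap f.
Proof.
move=> sf; rewrite (laplacianM oU Uy gsym (smooth_on_cst U t) sf).
by rewrite gradprod_cst laplacian_cst !mulr0 !addr0.
Qed.

Variable s : 'rV[R]_d -> R.
Hypotheses (ss : smooth_on U s) (s0 : forall z, U z -> s z != 0).

(** Division by [s y] avoids the exponent n - 1, so that n = 0 needs no separate formula. *)
Lemma gradprodX n h :
  <| fun z => s z ^+ n, h |> = n%:R * s y ^+ n * (<| s, h |> / s y).
Proof.
elim: n => [|n IH].
  have -> : (fun z => s z ^+ 0) = fun=> 1 by apply/funext => z; rewrite expr0.
  by rewrite gradprod_cst !mul0r.
have -> : (fun z => s z ^+ n.+1) = fun z => s z * s z ^+ n.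
  by apply/funext => z; rewrite exprS.
rewrite (gradprodM g e Uy h ss (smooth_onX n oU ss)) IH.
move: (<| s, h |>) (s y) (s0 Uy) => p t t0.
by rewrite [t ^+ n.+1]exprS -natr1; field.
Qed.

Lemma laplacianX n :
  lap (fun z => s z ^+ n) =
  n%:R * s y ^+ n * (lap s / s y + (n%:R - 1) * <| s, s |> / s y ^+ 2).
Proof.
elim: n => [|n IH].
  have -> : (fun z => s z ^+ 0) = fun=> 1 by apply/funext => z; rewrite expr0.
  by rewrite laplacian_cst !mul0r.
have -> : (fun z => s z ^+ n.+1) = fun z => s z * s z ^+ n.
  by apply/funext => z; rewrite exprS.
rewrite (laplacianM oU Uy gsym ss (smooth_onX n oU ss)) IH.
rewrite (gradprod_coordC gsym s (fun z => s z ^+ n)) gradprodX.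
move: (<| s, s |>) (lap s) (s y) (s0 Uy) => p l t t0.
by rewrite [t ^+ n.+1]exprS -natr1; field.
Qed.

Variables (b : 'rV[R]_d -> R) (j : R).
Hypotheses (sb : smooth_on U b) (d_gt0 : (0 < d)%N).

Lemma isq_improved :
  isq_coord e y g j s = 1 + s y ^+ d * b y ->
  isq_coord e y g j (fun z => s z * (1 + d%:R / 2 * ln `|s z| *
    ((s z ^+ d * b z) / (d%:R + 1)))) =
  let P := <| s, s |> in let r := <| s, b |> in let T := s y ^+ d.-1 in
  1 + s y ^+ d.+1 * (ln `|s y| * coefA d%:R (s y) T (b y) P r (lap s) (lap b) j
                     + coefB d%:R (s y) T (b y) P r (lap s) j)
    + s y ^+ (2 * d) * ln `|s y| ^+ 2
      * coefC d%:R (s y) (b y) P r <| b, b |> (lap s) (lap b) j.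
Proof.
(* Absorbing the prefactor [s] into the power gives the form s + k log |s| s^(d+1) b, whose
   derivatives reduce by the Leibniz rules to the variables of [expansion_identity]. *)
move=> hI; pose k : R := d%:R / 2 / (d%:R + 1).
pose l z := ln `|s z|; pose p z := s z ^+ d.+1; pose w z := p z * b z.
pose u z := l z * w z; pose f z := s z + k * u z.
have -> : (fun z => s z * (1 + d%:R / 2 * ln `|s z| *
    ((s z ^+ d * b z) / (d%:R + 1)))) = f.
  apply/funext => z; rewrite /f /u /k /l /w /p exprS.
  by move: (s z) (b z) (s z ^+ d) (ln _) => *; ring.
have sl : smooth_on U l by exact: smooth_on_ln_norm.
have sp : smooth_on U p by exact: smooth_onX.
have sw : smooth_on U w by exact: smooth_onM.
have su : smooth_on U u by exact: smooth_onM.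
have sk : smooth_on U (fun z => k * u z).
  by apply: smooth_onM => //; exact: smooth_on_cst.
have GS h : <| f, h |> = <| s, h |> + k * <| u, h |>.
  by rewrite (gradprodD g e Uy h ss sk) (gradprodZ _ _ su).
have GU h : <| u, h |> = l y * <| w, h |> + w y * <| l, h |>.
  exact: (gradprodM g e Uy h sl sw).
have GL h : <| l, h |> = <| s, h |> / s y.
  by exact: (gradprod_ln g e oU Uy h ss (s0 Uy)).
pose N : R := d%:R; set T := s y ^+ d.-1; set P := <| s, s |>.
set r := <| s, b |>; set q := <| b, b |>; set D := lap s; set E := lap b.
have sdE : s y ^+ d = s y * T by rewrite /T -exprS prednK.
have pE : p y = s y * (s y * T) by rewrite /p exprS sdE.
have wE : w y = s y * (s y * T) * b y by rewrite /w pE.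
have dN : (d.+1)%:R = N + 1 :> R by rewrite natr1.
have GP h : <| p, h |> = (N + 1) * (s y * T) * <| s, h |>.
  rewrite gradprodX dN exprS sdE.
  by move: (<| s, h |>) (s y) (s0 Uy) => x t t0; field.
have GC := @gradprod_coordC _ _ _ g e y gsym.
have GW h : <| w, h |> = s y * (s y * T) * <| b, h |>
    + b y * ((N + 1) * (s y * T) * <| s, h |>).
  by rewrite (gradprodM g e Uy h sp sb) GP pE.
have LP : lap p = (N + 1) * (s y * T) * (D + N * P / s y).
  rewrite laplacianX dN exprS sdE -/P -/D addrK.
  by move: P D (s y) (s0 Uy) => P' D' t t0; field.
have LW : lap w = s y * (s y * T) * E
    + b y * ((N + 1) * (s y * T) * (D + N * P / s y))
    + 2 * ((N + 1) * (s y * T) * r).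
  by rewrite (laplacianM oU Uy gsym sp sb) LP GP pE.
pose sw0 := s y * (s y * T) * r + b y * ((N + 1) * (s y * T) * P).
have SW : <| s, w |> = sw0 by rewrite GC GW (GC b).
have WW : <| w, w |> = s y * (s y * T) *
    (s y * (s y * T) * q + b y * ((N + 1) * (s y * T) * r))
    + b y * ((N + 1) * (s y * T) * sw0).
  by rewrite GW SW (GC b w) GW.
have LS : lap f = D + k * lap u.
  by rewrite (laplacianD oU Uy gsym ss sk) (laplacianZ _ su).
have LU : lap u =
    l y * lap w + w y * (D / s y - P / s y ^+ 2) + 2 * (sw0 / s y).
  rewrite (laplacianM oU Uy gsym sl sw) GL SW.
  by rewrite (laplacian_ln oU Uy gsym ss s0).
have SU : <| s, u |> = l y * sw0 + w y * (P / s y).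
  by rewrite GC GU GL (GC w) SW.
have UU : <| u, u |> =
    l y * (l y * <| w, w |> + w y * (sw0 / s y))
    + w y * (l y * (sw0 / s y) + w y * (P / s y / s y)).
  by rewrite GU (GC w u) (GC l u) !GU (GC w l) !GL (GC s l) !GL SW.
move: hI; rewrite /isq_coord !gradsq_coordE -/P -/D sdE => hI.
have N0 : N != 0 by rewrite pnatr_eq0 -lt0n.
have N1 : N + 1 != 0 by rewrite natr1 pnatr_eq0.
have -> : f y = s y + k * (l y * w y) by [].
rewrite GS (GC s f) GS (GC u f) GS (GC u s) SU UU LS LU LW WW wE.
rewrite [s y ^+ d.+1]exprS [s y ^+ (2 * d)](_ : _ = (s y ^+ d) ^+ 2);
  last first.
  by rewrite -exprM mulnC.
rewrite sdE.
exact: (expansion_identity (l y) r q E (s0 Uy) N0 N1 hI).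
Qed.

End ImprovedInChart.

(** * Densities *)

Section Densities.
Variables (R : realType) (d : nat) (M : topologicalType).
Variable X : oriented_manifold R d M.
Implicit Types (g : metric R d M) (x : M).

Lemma IsqE (sigma : density R d M) g x : let e := chart_at X x in
  Isq X sigma g x =
  isq_coord e (coord e x) g (Jcurv X g x) (local_rep e (sigma g)).
Proof.
have [_ ex] := chart_atP X x.
by rewrite /isq_coord /Isq /gradsq /laplacian /local_rep coordK.
Qed.

(** The calculus takes place on this open set because the logarithm, and with it sigma', is known to
    be smooth only off the zeros of sigma. *)
Definition nonzero_img (e : chart R d M) (f : M -> R) : set 'rV[R]_d :=
  (coord e @` dom e) `&` [set y | local_rep e f y != 0].

Lemma open_nonzero_img e f : atlas X e -> smooth X f -> open (nonzero_img e f).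
Proof.
by move=> eX sf; apply: smooth_on_open_neq0; [exact: img_open|exact: sf].
Qed.

Lemma nonzero_imgP e f x : dom e x -> f x != 0 -> nonzero_img e f (coord e x).
Proof. by move=> ex fx; split; [exists x|rewrite /= /local_rep coordK]. Qed.

Lemma smooth_on_nonzero_img e f h : atlas X e -> smooth X h ->
  smooth_on (nonzero_img e f) (local_rep e h).
Proof. by move=> eX sh; apply: smooth_on_sub (sh e eX) => z []. Qed.

(* By [isq_coord_rescaled] the change of I^2 under a rescaling is [W] times the
   square of the density with [W] independent of it; the invariance of
   I^2_sigma where sigma is nonzero thus forces [W = 0], which replaces the
   conformal transformation law of the scalar curvature. *)
Lemma Isq_rescaled (hd : (0 < d)%N) g g' (Omega : M -> R)
    (sigma u : density R d M) x :
  riemannian X g -> rescaled X Omega g g' ->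
  (forall z, sigma g' z = Omega z * sigma g z) ->
  (forall z, u g' z = Omega z * u g z) ->
  smooth X (sigma g) -> sigma g x != 0 ->
  smooth_on (nonzero_img (chart_at X x) (sigma g)) (local_rep (chart_at X x) (u g)) ->
  Isq X sigma g' x = Isq X sigma g x -> Isq X u g' x = Isq X u g x.
Proof.
move=> rg gg' sE uE ss sx su; rewrite !IsqE.
have [eX ex] := chart_atP X x; set e := chart_at X x in eX ex su *.
have oU := open_nonzero_img eX ss; have Uy := nonzero_imgP ex sx.
have [W HW] := isq_coord_rescaled rg gg' eX Uy.1 hd (Jcurv X g x) (Jcurv X g'
  x).
have E (v : density R d M) : (forall z, v g' z = Omega z * v g z) ->
    local_rep e (v g') = fun z => local_rep e Omega z * local_rep e (v g) z.
  by move=> vE; apply/funext => z; exact: vE.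
have Ui z : nonzero_img e (sigma g) z -> (coord e @` dom e) z by case.
rewrite (E _ sE) (E _ uE) (HW _ _ oU Uy su Ui).
rewrite (HW _ _ oU Uy (smooth_on_nonzero_img _ eX ss) Ui).
move/eqP; rewrite -subr_eq0 addrAC subrr add0r mulf_eq0 sqrf_eq0.
have -> : local_rep e (sigma g) (coord e x) == 0 = false.
  by rewrite /local_rep coordK //; exact: negbTE.
by move=> /eqP ->; rewrite mulr0 addr0.
Qed.

Variable c : set (metric R d M).

Lemma rescaled_trans Om1 Om2 g1 g2 g3 : rescaled X Om1 g1 g2 ->
  rescaled X Om2 g2 g3 -> rescaled X (fun x => Om2 x * Om1 x) g1 g3.
Proof.
move=> [s1 p1 E1] [s2 p2 E2]; split; first exact: smoothM.
  by move=> x; exact: mulr_gt0.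
by move=> e x eX ex; rewrite E2 // E1 // scalerA exprMn.
Qed.

Lemma rescaled_inv Om g g' :
  rescaled X Om g g' -> rescaled X (fun x => (Om x)^-1) g' g.
Proof.
move=> [sO O0 gE]; have n0 x : Om x != 0 by rewrite gt_eqF.
split; first exact: smoothV.
  by move=> x; rewrite invr_gt0.
move=> e x eX ex; rewrite gE // scalerA -exprMn mulVf // expr1n scale1r //.
Qed.

Lemma conformal_class_riemannian g : conformal_class X c -> c g -> riemannian X g.
Proof.
by move=> [gb rb cE] /cE [Om rOm]; exact: riemannian_rescaled rb rOm.
Qed.

Lemma conformal_class_rescaled g g' : conformal_class X c -> c g -> c g' ->
  exists Om, rescaled X Om g g'.
Proof.
move=> [gb rb cE] /cE[Om1 r1] /cE[Om2 r2].
by exists (fun x => Om2 x * (Om1 x)^-1);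
  exact: rescaled_trans (rescaled_inv r1) r2.
Qed.

Lemma conformal_class_closed Om g g' : conformal_class X c -> c g ->
  rescaled X Om g g' -> c g'.
Proof.
move=> [gb rb cE] /cE[Om1 r1] r2; apply/cE.
by exists (fun x => Om x * Om1 x); exact: rescaled_trans r1 r2.
Qed.

Variable tau : density R d M.
Hypotheses (hc : conformal_class X c) (htau : true_scale X c tau).

Lemma true_scale_norm_neq0 g x : c g -> `|tau g x| != 0.
Proof. by move=> cg; rewrite normr_eq0; exact: htau.2. Qed.

Lemma smooth_true_scale_norm g : c g -> smooth X (fun x => `|tau g x|).
Proof.
by move=> cg; apply: smooth_norm; [move=> x; exact: htau.2|exact: htau.1.1].
Qed.

Lemma norm_true_scale_rescaled g g' Om x : c g -> c g' ->
  rescaled X Om g g' -> `|tau g' x| = Om x * `|tau g x|.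
Proof.
move=> cg cg' r; rewrite (htau.1.2 _ _ _ cg cg' r) expr1z normrM gtr0_norm //.
by case: r.
Qed.

Lemma unit_scale : exists g0, [/\ c g0, forall x, `|tau g0 x| = 1
  & forall g, c g -> rescaled X (fun x => `|tau g x|) g0 g].
Proof.
have [gb cb] : exists gb, c gb.
  have [gb rb cE] := hc; exists gb; apply/cE; exists (fun=> 1).
  split; [exact: smooth_cst|by []|].
  by move=> e x _ _; rewrite expr1n scale1r.
(* Since tau has weight 1, rescaling by Omega = |tau|^(-1) normalises it; from this scale the factor
   to any other [g] must then be |tau_g|. *)
pose g0 : metric R d M := fun e x => `|tau gb x| ^- 2 *: gb e x.
have r0 : rescaled X (fun x => `|tau gb x|^-1) gb g0.
  split.
  - by apply: smoothV => [x|]; [exact: true_scale_norm_neq0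
                               |exact: smooth_true_scale_norm].
  - by move=> x; rewrite invr_gt0 normr_gt0; exact: htau.2.
  - by move=> e x _ _; rewrite exprVn.
have c0 := conformal_class_closed hc cb r0.
have t0 x : `|tau g0 x| = 1.
  by rewrite (norm_true_scale_rescaled _ cb c0 r0) mulVf //
    true_scale_norm_neq0.
exists g0; split=> // g cg.
have [Om r] := conformal_class_rescaled hc c0 cg.
have -> : (fun x => `|tau g x|) = Om; last exact: r.
by apply/funext => x; rewrite (norm_true_scale_rescaled _ c0 cg r) t0 mulr1.
Qed.

(** |tau| is a smooth positive density of weight 1, so its powers carry the weight. In the scale
    where |tau| = 1 the representative is [F] itself. *)
Lemma smooth_density_extension (w : int) (F : M -> R) : smooth X F ->
  smooth_density X c w (fun g x => `|tau g x| ^ w * F x).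
Proof.
move=> sF; split=> [g cg|g g' Om cg cg' r x].
  apply: smoothM => //; have st := smooth_true_scale_norm cg.
  case: w => n; first exact: smoothX.
  apply: smoothV; last exact: smoothX.
  by move=> x; rewrite expf_neq0 // true_scale_norm_neq0.
by rewrite (norm_true_scale_rescaled _ cg cg' r) expfzMl mulrA.
Qed.

Lemma smooth_densityM (w1 w2 : int) (f h : density R d M) :
  smooth_density X c w1 f -> smooth_density X c w2 h ->
  smooth_density X c (w1 + w2) (fun g x => f g x * h g x).
Proof.
move=> [sf cf] [sh ch]; split=> [g cg|g g' Om cg cg' r x].
  by apply: smoothM; [exact: sf|exact: sh].
have [_ O0 _] := r; rewrite (cf _ _ _ cg cg' r) (ch _ _ _ cg cg' r).
by rewrite expfzDr ?gt_eqF // mulrACA.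
Qed.

Lemma smooth_densityX (n : nat) (f : density R d M) : smooth_density X c 1 f ->
  smooth_density X c n%:Z (fun g x => f g x ^+ n).
Proof.
move=> [sf cf]; split=> [g cg|g g' Om cg cg' r x]; first exact/smoothX/sf.
by rewrite (cf _ _ _ cg cg' r) expr1z exprMn.
Qed.

End Densities.

Section SmoothCoefficients.
Variables (R : realType) (d : nat) (M : topologicalType).
Variables (X : oriented_manifold R d M) (N : R).
Variables s T b P r q D E j : M -> R.
Hypotheses (ss : smooth X s) (sT : smooth X T) (sb : smooth X b).
Hypotheses (sP : smooth X P) (sr : smooth X r) (sq : smooth X q).
Hypotheses (sD : smooth X D) (sE : smooth X E) (sj : smooth X j).

Let smoothN (u : M -> R) : smooth X u -> smooth X (fun x => - u x).
Proof. by move=> su e eX; apply: smooth_onN (su e eX); exact: img_open. Qed.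

Local Ltac smooth_tac := repeat first
  [ assumption | exact: smooth_cst | apply: smoothD | apply: smoothN
  | apply: smoothX | apply: smoothM ].

Lemma smooth_coefA :
  smooth X (fun x => coefA N (s x) (T x) (b x) (P x) (r x) (D x) (E x) (j x)).
Proof. by rewrite /coefA; smooth_tac. Qed.

Lemma smooth_coefB :
  smooth X (fun x => coefB N (s x) (T x) (b x) (P x) (r x) (D x) (j x)).
Proof. by rewrite /coefB; smooth_tac. Qed.

Lemma smooth_coefC :
  smooth X (fun x => coefC N (s x) (b x) (P x) (r x) (q x) (D x) (E x) (j x)).
Proof. by rewrite /coefC; smooth_tac. Qed.

End SmoothCoefficients.

(** * Expansion of I^2 of sigma' in every scale of the class *)

Theorem proposition4p11 (R : realType) (d : nat) (hd : (3 <= d)%N)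
    (M : topologicalType) (X : oriented_manifold R d M)
    (c : set (metric R d M)) (hc : conformal_class X c)
    (Sigma : set M) (hSigma : hypersurface X Sigma)
    (sigma tau : density R d M)
    (hsigma : conformal_unit_defining_density X c Sigma sigma)
    (htau : true_scale X c tau) :
  let sigma' := improved_density X sigma tau in
  (exists A B' C : density R d M,
     [/\ smooth_density X c (- d%:Z - 1) A,
         smooth_density X c (- d%:Z - 1) B',
         smooth_density X c (- (2 * d)%:Z) C
       & forall g, c g -> forall x, ~ Sigma x ->
           Isq X sigma' g x =
             1 + sigma g x ^+ d.+1
                 * (log_ratio sigma tau g x * A g x + B' g x)
               + sigma g x ^+ (2 * d) * log_ratio sigma tau g x ^+ 2 * C g x])
  /\ eq_Otilde X c Sigma sigma 0 d.+1 (Isq X sigma') (fun _ _ => 1).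
Proof.
move=> sigma'; have d_gt0 : (0 < d)%N by exact: leq_trans hd.
have [[sSigma sigma0 _] [B sB IB]] := hsigma.
have [g0 [cg0 tau1 rg0]] := unit_scale hc htau.
have rie0 := conformal_class_riemannian hc cg0.
pose s := sigma g0; pose b := B g0.
have ss : smooth X s := sSigma.1 _ cg0; have sb : smooth X b := sB.1 _ cg0.
pose P := gradprod X g0 s s; pose r := gradprod X g0 s b.
pose q := gradprod X g0 b b; pose D := laplacian X g0 s.
pose E := laplacian X g0 b; pose j := Jcurv X g0.
pose T x := s x ^+ d.-1; pose N : R := d%:R.
have sT : smooth X T by exact: smoothX.
have sP : smooth X P by exact: (smooth_gradprod rie0).
have sr : smooth X r by exact: (smooth_gradprod rie0).
have sq : smooth X q by exact: (smooth_gradprod rie0).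
have sD : smooth X D by exact: (smooth_laplacian rie0).
have sE : smooth X E by exact: (smooth_laplacian rie0).
have sj : smooth X j by exact: (smooth_Jcurv rie0).
pose A0 x := coefA N (s x) (T x) (b x) (P x) (r x) (D x) (E x) (j x).
pose B0 x := coefB N (s x) (T x) (b x) (P x) (r x) (D x) (j x).
pose C0 x := coefC N (s x) (b x) (P x) (r x) (q x) (D x) (E x) (j x).
pose ext (w : int) (F : M -> R) : density R d M := fun g x =>
  `|tau g x| ^ w * F x.
pose A := ext (- d%:Z - 1) A0; pose B' := ext (- d%:Z - 1) B0.
pose C := ext (- (2 * d)%:Z) C0.
have dA : smooth_density X c (- d%:Z - 1) A.
  by apply: smooth_density_extension => //; exact: smooth_coefA.
have dB' : smooth_density X c (- d%:Z - 1) B'.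
  by apply: smooth_density_extension => //; exact: smooth_coefB.
have dC : smooth_density X c (- (2 * d)%:Z) C.
  by apply: smooth_density_extension => //; exact: smooth_coefC.
have sigmaE g x : c g -> sigma g x = `|tau g x| * s x.
  by move=> cg; rewrite (sSigma.2 _ _ _ cg0 cg (rg0 _ cg)) expr1z.
have s_neq0 x : ~ Sigma x -> s x != 0.
  by move=> nSx; apply/eqP => /(sigma0 _ cg0 x).
have tau_neq0 g x : c g -> `|tau g x| != 0.
  by move=> cg; exact: (true_scale_norm_neq0 htau).
have logE g x : c g -> s x != 0 -> log_ratio sigma tau g x = ln `|s x|.
  move=> cg sx; rewrite /log_ratio /log_density sigmaE // normrM normr_id.
  have t0 : tau g x != 0 by exact: htau.2.
  by rewrite lnM ?posrE ?normr_gt0 // addrAC subrr add0r.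
(* sigma^d B has weight 0, so I^2 of sigma is the same function in all scales, which is the
   invariance that [Isq_rescaled] asks for. *)
have IsqS g x : c g -> Isq X sigma g x - 1 = s x ^+ d * b x.
  move=> cg; rewrite IB // addrAC subrr add0r sigmaE // exprMn.
  rewrite (sB.2 _ _ _ cg0 cg (rg0 _ cg)) -exprnN.
  by rewrite mulrACA mulfV ?mul1r // expf_neq0 // tau_neq0.
have improvedE g x : c g -> sigma' g x = `|tau g x| * (s x *
    (1 + d%:R / 2 * ln `|s x| * ((s x ^+ d * b x) / (d%:R + 1)))).
  move=> cg; rewrite /sigma' /improved_density IsqS // sigmaE //.
  (* On the zero locus the logarithms are junk, but the prefactor vanishes on both sides. Thus
     sigma' rescales with weight 1 at every point, as [Isq_rescaled] requires. *)
  have [->|sx] := eqVneq (s x) 0; first by rewrite !(mulr0, mul0r).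
  by rewrite logE // -[LHS]mulrA.
have main g x : c g -> ~ Sigma x -> Isq X sigma' g x =
    1 + sigma g x ^+ d.+1 * (log_ratio sigma tau g x * A g x + B' g x)
    + sigma g x ^+ (2 * d) * log_ratio sigma tau g x ^+ 2 * C g x.
  move=> cg nSx; have sx := s_neq0 x nSx.
  have [eX ex] := chart_atP X x; set e := chart_at X x in eX ex.
  pose U := nonzero_img e s.
  have oU : open U := open_nonzero_img eX ss.
  have Uy : U (coord e x) := nonzero_imgP ex sx.
  have ssU : smooth_on U (local_rep e s) := smooth_on_nonzero_img s eX ss.
  have sbU : smooth_on U (local_rep e b) := smooth_on_nonzero_img s eX sb.
  have uE : local_rep e (sigma' g0) = fun z => local_rep e s z *
      (1 + d%:R / 2 * ln `|local_rep e s z| *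
        ((local_rep e s z ^+ d * local_rep e b z) / (d%:R + 1))).
    by apply/funext => z; rewrite {1}/local_rep improvedE // tau1 mul1r.
  have su : smooth_on U (local_rep e (sigma' g0)).
    rewrite uE; have sc (t : R) := smooth_on_cst U t.
    have sl : smooth_on U (fun z => ln `|local_rep e s z|).
      by apply: smooth_on_ln_norm => // z [].
    apply: smooth_onM => //; apply: smooth_onD => //.
    apply: smooth_onM => //; first exact: smooth_onM.
    by apply: smooth_onM => //; apply: smooth_onM => //; exact: smooth_onX.
  rewrite (Isq_rescaled (sigma := sigma) d_gt0 rie0 (rg0 _ cg)) //; first last.
  - by apply/(addIr (-1)); rewrite !IsqS.
  - by move=> z; rewrite !improvedE // tau1 mul1r.
  - by move=> z; exact: sigmaE.
  have xE (f : M -> R) : local_rep e f (coord e x) = f x by rewrite /local_rep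
    coordK.
  have hI : isq_coord e (coord e x) g0 (j x) (local_rep e s) =
      1 + local_rep e s (coord e x) ^+ d * local_rep e b (coord e x).
    by rewrite -(IsqE X sigma g0 x) !xE -(IsqS g0 x cg0) addrC subrK.
  have gsym := metric_mx_sym rie0 eX Uy.1.
  have s0U z : U z -> local_rep e s z != 0 by case.
  have := isq_improved oU Uy gsym ssU s0U sbU d_gt0 hI.
  rewrite /= !xE IsqE -/e uE => ->; rewrite sigmaE // logE // !exprMn.
  rewrite /A /B' /C /ext; set t := `|tau g x|; have t0 : t != 0 :=
    tau_neq0 g x cg.
  (* The weights of the coefficients offset the powers of |tau| contained in sigma^(d+1) and, in
     [t2], in sigma^(2d). *)
  have t1 : t ^+ d.+1 * t ^ (- d%:Z - 1) = 1.
    have -> : - d%:Z - 1 = - (d.+1)%:Z by lia.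
    by rewrite -exprnN mulfV // expf_neq0.
  have t2 : t ^+ (2 * d) * t ^ (- (2 * d)%:Z) = 1.
    by rewrite -exprnN mulfV // expf_neq0.
  congr (_ + _ + _).
    rewrite mulrCA -mulrDr mulrACA t1 mul1r //.
  transitivity (s x ^+ (2 * d) * ln `|s x| ^+ 2 * C0 x); first by [].
  rewrite -[LHS]mul1r -t2.
  move: (t ^+ (2 * d)) (t ^ _) (s x ^+ (2 * d)) (ln _) (C0 x).
  by move=> *; ring.
split; first by exists A, B', C; split => // g cg x; exact: main.
(* Coefficients of the powers 0, 1, 2 of the logarithm. In the last one 2d = (d + 1) + (d - 1), so
   sigma^(d-1) stays with [C], and the weight is (d - 1) - 2d = -d - 1 as required. *)
exists 2, (fun i => if i is i'.+1 then if i' is 0%N then A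
    else fun g x => sigma g x ^+ d.-1 * C g x else B'), tau.
have wE : 0 - (d.+1)%:Z = - d%:Z - 1 by lia.
split=> //.
  move=> [|[|i]] _; rewrite wE //.
  have -> : - d%:Z - 1 = (d.-1)%:Z + - (2 * d)%:Z by lia.
  by apply: smooth_densityM => //; exact: smooth_densityX.
move=> g cg x nSx; rewrite main // !big_ord_recr big_ord0 /= add0r expr0 mul1r
  expr1.
have dE : (2 * d = d.+1 + d.-1)%N by lia.
rewrite {1}dE exprD.
by move: (sigma g x) (log_ratio _ _ _ _) (A g x) (B' g x) (C g x) => *; ring.
Qed.
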